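(* Every pants-like $\mathrm{COL}_3$ subgroup $G$ of $\mathrm{Homeo}^+(S^1)$ is a convergence group.
   Context: $S^1$ is the unit circle in $\mathbb{C}$, oriented counterclockwise, and $\mathrm{Homeo}^+(S^1)$ is the group of its orientation preserving homeomorphisms. For distinct $u,v\in S^1$, $(u,v)_{S^1}$ denotes the set of $p\in S^1$ such that $(u,p,v)$ is counterclockwise ordered; such sets are the nondegenerate open intervals. The dual of $I=(u,v)_{S^1}$ is $I^*=(v,u)_{S^1}$. The pair $\{I,I^*\}$ lies on a nondegenerate open interval $J$ if $I\subseteq J$ or $I^*\subseteq J$. A lamination system is a nonempty family $\mathcal{L}$ of nondegenerate open intervals such that: (1) $I\in\mathcal{L}$ implies $I^*\in\mathcal{L}$; (2) for all $I,J\in\mathcal{L}$, $\{I,I^*\}$ lies on $J$ or on $J^*$; (3) if $I_n\in\mathcal{L}$, $I_n\subseteq I_{n+1}$ for all $n\in\mathbb{N}$, and $\bigcup_n I_n$ is a nondegenerate open interval, then $\bigcup_n I_n\in\mathcal{L}$. A leaf is a set $\ell(I)=\{I,I^*\}$ with $I\in\mathcal{L}$. A gap is a subset $\mathscr{G}\subseteq\mathcal{L}$ whose elements are pairwise disjoint and such that for each $I\in\mathcal{L}$ there is $J\in\mathscr{G}$ on which $\ell(I)$ lies; $v(\mathscr{G})=S^1\setminus\bigcup_{I\in\mathscr{G}}I$. $\mathcal{L}$ is very full if $v(\mathscr{G})$ is finite for every gap $\mathscr{G}$. $E(\mathcal{L})=\bigcup_{I\in\mathcal{L}}v(\ell(I))$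 is the set of end points of leaves. $\mathcal{L}$ is $G$-invariant if $g(I)\in\mathcal{L}$ for all $g\in G$, $I\in\mathcal{L}$. Two lamination systems are transverse if they are disjoint as sets. A nontrivial $g\in\mathrm{Homeo}^+(S^1)$ is parabolic if it has exactly one fixed point in $S^1$. A cusp point of $G$ is a point of $S^1$ fixed by some parabolic element of $G$. A collection $\{\mathcal{L}_\alpha\}$ of $G$-invariant very full lamination systems is pants-like if its members are pairwise transverse and, for $\alpha\neq\beta$, every point of $E(\mathcal{L}_\alpha)\cap E(\mathcal{L}_\beta)$ is a cusp point of $G$. $G$ is pants-like $\mathrm{COL}_n$ if it admits a pants-like collection with $n$ elements. A sequence of distinct elements of $G$ has the convergence property if there are points $a,b\in S^1$ (not necessarily distinct) and a subsequence $\{g_n\}$ such that $g_n|_{S^1\setminus\{b\}}$ converges to the constant map with value $a$ uniformly on every compact subset of $S^1\setminus\{b\}$. $G$ is a convergence group if every sequence of distinct elements of $G$ has the convergence property. *)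

(* Defs.v *)
From HB Require Import structures.
From mathcomp Require Import all_boot all_order all_algebra.
From mathcomp Require Import all_classical all_reals all_analysis.
From mathcomp Require Import complex.

Set Implicit Arguments.
Unset Strict Implicit.
Unset Printing Implicit Defensive.

Import Order.TTheory GRing.Theory Num.Theory.
Import numFieldNormedType.Exports.

Local Open Scope classical_set_scope.
Local Open Scope ring_scope.

(* [R[i]^o] is [R[i]] carrying the topology and uniformity of its modulus;
   [circle R] inherits the subspace topology and uniformity. *)
Definition unit_circle (R : realType) : set R[i]^o := [set z | `|z| = 1].

Arguments unit_circle R : clear implicits.

Notation circle R := (set_type (unit_circle R)).

Definition cis (R : realType) (t : R) : R[i] := (cos t +i* sin t)%C.

(* Starting from u and moving counterclockwise, one meets p and then v before
   coming back to u; in particular u, p, v are distinct. *)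
Definition ccw (R : realType) (u p v : circle R) : Prop :=
  exists s t : R, [/\ 0 < s, s < t & t < 2 * pi] /\
    val p = val u * cis s :> R[i] /\ val v = val u * cis t :> R[i].

Definition arc (R : realType) (u v : circle R) : set (circle R) :=
  [set p | ccw u p v].

Definition open_interval (R : realType) (I : set (circle R)) : Prop :=
  exists u v : circle R, u <> v /\ I = arc u v.

(* The end points of a nondegenerate open interval are determined by it, so the
   witnesses u, v below are unique and [dual (arc u v) = arc v u]. *)
Definition dual (R : realType) (I : set (circle R)) : set (circle R) :=
  [set p | exists u v : circle R, [/\ u <> v, I = arc u v & arc v u p]].

Definition leaf (R : realType) (I : set (circle R)) : set (set (circle R)) :=
  [set I; dual I].

Definition lies_on (R : realType) (l : set (set (circle R)))
    (J : set (circle R)) : Prop :=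
  exists2 I, l I & I `<=` J.

Definition lamination_system (R : realType) (L : set (set (circle R))) : Prop :=
  [/\ L !=set0 /\ L `<=` @open_interval R,
      forall I, L I -> L (dual I),
      forall I J, L I -> L J -> lies_on (leaf I) J \/ lies_on (leaf I) (dual J)
    & forall I : nat -> set (circle R),
        (forall n, L (I n)) -> (forall n, I n `<=` I n.+1) ->
        open_interval (\bigcup_n I n) -> L (\bigcup_n I n)].

Definition gap (R : realType) (L P : set (set (circle R))) : Prop :=
  [/\ P `<=` L, trivIset P id
    & forall I, L I -> exists2 J, P J & lies_on (leaf I) J].

Definition vertices (R : realType) (P : set (set (circle R))) :
    set (circle R) :=
  ~` (\bigcup_(I in P) I).

Definition very_full (R : realType) (L : set (set (circle R))) : Prop :=
  forall P, gap L P -> finite_set (vertices P).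

Definition end_points (R : realType) (L : set (set (circle R))) :
    set (circle R) :=
  \bigcup_(I in L) vertices (leaf I).

Definition transverse (R : realType) (L M : set (set (circle R))) : Prop :=
  L `&` M = set0.

Definition orientation_preserving (R : realType) (g : circle R -> circle R) :
    Prop :=
  forall u p v, ccw u p v -> ccw (g u) (g p) (g v).

Definition homeo_plus (R : realType) : set (circle R -> circle R) :=
  [set g | [/\ continuous g,
               exists h : circle R -> circle R,
                 [/\ continuous h, cancel g h & cancel h g]
             & orientation_preserving g]].

Arguments homeo_plus R : clear implicits.

Definition subgroup_homeo_plus (R : realType) (G : set (circle R -> circle R)) :
    Prop :=
  [/\ G `<=` homeo_plus R, G id,
      forall f g, G f -> G g -> G (f \o g)
    & forall g h, G g -> cancel g h -> cancel h g -> G h].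

Definition invariant_under (R : realType) (G : set (circle R -> circle R))
    (L : set (set (circle R))) : Prop :=
  forall g I, G g -> L I -> L (g @` I).

Definition parabolic (R : realType) (g : circle R -> circle R) : Prop :=
  [/\ homeo_plus R g, g <> id & exists! x, g x = x].

Definition cusp_point (R : realType) (G : set (circle R -> circle R))
    (x : circle R) : Prop :=
  exists g, [/\ G g, parabolic g & g x = x].

Definition pants_like (R : realType) (G : set (circle R -> circle R))
    (A : Type) (L : A -> set (set (circle R))) : Prop :=
  [/\ forall a, [/\ lamination_system (L a), invariant_under G (L a)
                  & very_full (L a)],
      forall a b, a <> b -> transverse (L a) (L b)
    & forall a b, a <> b ->
        end_points (L a) `&` end_points (L b) `<=` cusp_point G].

(* Members of a pants-like family are nonempty and pairwise disjoint, so a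
   family indexed by ['I_n] is a collection with exactly n elements. *)
Definition pants_like_COL (R : realType) (n : nat)
    (G : set (circle R -> circle R)) : Prop :=
  subgroup_homeo_plus G /\
  exists L : 'I_n -> set (set (circle R)), pants_like G L.

Definition convergence_property (R : realType)
    (g : nat -> circle R -> circle R) : Prop :=
  exists (a b : circle R) (k : nat -> nat),
    {homo k : m n / (m < n)%N} /\
    forall K : set (circle R), compact K -> K `<=` ~` [set b] ->
      {uniform K, (fun n => g (k n)) @ \oo --> cst a}.

Definition convergence_group (R : realType) (G : set (circle R -> circle R)) :
    Prop :=
  forall g : nat -> circle R -> circle R,
    injective g -> (forall n, G (g n)) -> convergence_property g.

(* Main.v *)
From mathcomp Require Import all_boot all_order all_algebra.
From mathcomp Require Import all_classical all_reals all_analysis.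
From mathcomp Require Import complex ring lra zify.
Require Import Defs.

(* Work with the cyclic order of the circle and with limits along an
   ultrafilter U on the indices of a sequence g of distinct elements. In a very
   full lamination, a point p that is not an end of a leaf is surrounded by
   arbitrarily short leaves (a rainbow at p): otherwise the maximal arcs of the
   lamination missing p would form a gap, and finiteness of its vertices would
   make p an end of one of its sides. A parabolic element excludes a rainbow at
   its fixed point, so a cusp is an end of leaves of all three laminations, and
   any other point has rainbows in at least two of them.

   If a nontrivial element of G fixes p <> q, let ]x, y[ be a component of the
   complement of its fixed points. Pushing leaves towards the ends of ]x, y[
   shows that x and y are not cusps, since {x, y} would be a leaf of two
   transverse laminations, and that a third fixed point would make y an end of
   leaves of two laminations, hence a cusp. So an element fixing three points,
   or a cusp and another point, is trivial. The stabilizer of a cusp p acts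
   freely and discretely on the rest of the circle, because the two sets of ends
   of the leaves from p in two of the laminations are closed, invariant and
   disjoint.

   Let f be the limit of g along U. If f is injective, some g_m^-1 g_n <> id is
   arbitrarily close to id; at a cusp this contradicts discreteness, and without
   cusps three rainbows of one lamination give three fixed points. Otherwise f
   is constant, equal to a, on some arc; either g collapses the complement of a
   point to a, or f jumps from a to other values at some y. In the latter case
   the leaves around (or ending at) y give leaves ending at a in two
   laminations, so that a is a cusp and g_n u = a for U-many n and a fixed u;
   the sequence is then governed by the stabilizer of a cusp. *)

Set Implicit Arguments.
Unset Strict Implicit.
Unset Printing Implicit Defensive.

Import Order.TTheory GRing.Theory Num.Theory.
Import numFieldNormedType.Exports.

Local Open Scope classical_set_scope.
Local Open Scope ring_scope.

(** * A decision procedure for cyclic orders *)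

(** With [th] a coordinate on the circle cut open, the disjuncts are the three rotations of one
    linear order. *)
Definition cc {R : realType} {S : Type} (th : S -> R) (a b c : S) : bool :=
  [|| (th a < th b) && (th b < th c), (th b < th c) && (th c < th a)
    | (th c < th a) && (th a < th b)].

(* A formula over finitely many points is decided by enumerating their weak
   orders on the circle cut just before the first point: a new point either
   equals an old one or comes right after one of them. *)
Inductive cyc_form : Type :=
| CycOrd of nat & nat & nat
| CycNOrd of nat & nat & nat
| CycSame of nat & nat & nat & nat & nat & nat
| CycEq of nat & nat
| CycFalse
| CycNot of cyc_form
| CycAnd of cyc_form & cyc_form
| CycOr of cyc_form & cyc_form
| CycImp of cyc_form & cyc_form.

Fixpoint cyc_denote {R : realType} {S : Type} (th : S -> R) (v : nat -> S)
    (f : cyc_form) : Prop :=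
  match f with
  | CycOrd i j k => cc th (v i) (v j) (v k)
  | CycNOrd i j k => ~~ cc th (v i) (v j) (v k)
  | CycSame i j k i' j' k' =>
    cc th (v i) (v j) (v k) = cc th (v i') (v j') (v k')
  | CycEq i j => v i = v j
  | CycFalse => False
  | CycNot f => ~ cyc_denote th v f
  | CycAnd f g => cyc_denote th v f /\ cyc_denote th v g
  | CycOr f g => cyc_denote th v f \/ cyc_denote th v g
  | CycImp f g => cyc_denote th v f -> cyc_denote th v g
  end.

Definition cyc_nat (a b c : nat) : bool :=
  ((a < b) && (b < c) || (b < c) && (c < a) || (c < a) && (a < b))%N.

(** Kleene disjunction: a true disjunct decides the result while the other is still unknown, which
    lets the search stop early. *)
Definition or3v (a b : option bool) : option bool :=
  match a, b with
  | Some true, _ | _, Some true => Some true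
  | Some false, Some false => Some false
  | _, _ => None
  end.

Definition cyc_eval_ord (r : seq nat) (i j k : nat) : option bool :=
  if [&& i < size r, j < size r & k < size r]%N
  then Some (cyc_nat (nth 0%N r i) (nth 0%N r j) (nth 0%N r k)) else None.

(* Three-valued: [None] as long as the ranks of some variables are missing. *)
Fixpoint cyc_eval (r : seq nat) (f : cyc_form) : option bool :=
  match f with
  | CycOrd i j k => cyc_eval_ord r i j k
  | CycNOrd i j k => omap negb (cyc_eval_ord r i j k)
  | CycSame i j k i' j' k' =>
    if cyc_eval_ord r i j k is Some b
    then omap (eq_op b) (cyc_eval_ord r i' j' k') else None
  | CycFalse => Some false
  | CycEq i j =>
    if (i < size r)%N && (j < size r)%N
    then Some (nth 0%N r i == nth 0%N r j) else None
  | CycNot f => omap negb (cyc_eval r f)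
  | CycAnd f g =>
    omap negb (or3v (omap negb (cyc_eval r f)) (omap negb (cyc_eval r g)))
  | CycOr f g => or3v (cyc_eval r f) (cyc_eval r g)
  | CycImp f g => or3v (omap negb (cyc_eval r f)) (cyc_eval r g)
  end.

(** Makes room for the rank [k.+1] of a point inserted just above rank [k]. *)
Definition shift_above (k i : nat) : nat := if (k < i)%N then i.+1 else i.

Fixpoint cyc_search (n : nat) (r : seq nat) (f : cyc_form) : bool :=
  if cyc_eval r f is Some true then true else
  if n is n'.+1 then
    all (fun k => cyc_search n' (rcons r k) f
               && cyc_search n' (rcons (map (shift_above k) r) k.+1) f) (undup r)
  else false.

Section Decision.
Context {R : realType} {S : Type} (th : S -> R).
Hypothesis thI : injective th.

(* The linear order obtained by cutting the circle just before [p]. *)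
Definition cut_lt (p x y : S) : bool :=
  if (th x < th p) == (th y < th p) then th x < th y else th y < th p.

(** The cyclic order does not depend on the cut: moving the points before [p] to the end only
    rotates each triple. *)
Lemma cc_cut p a b c : cc th a b c =
  [|| cut_lt p a b && cut_lt p b c, cut_lt p b c && cut_lt p c a
    | cut_lt p c a && cut_lt p a b].
Proof.
rewrite /cc /cut_lt.
case: (ltP (th a) (th p)) => ?; case: (ltP (th b) (th p)) => ?; case: (ltP (th c)
  (th p)) => ? /=;
  try by apply/idP/idP => //; lra.
Qed.

Lemma cut_lt_min p x : x <> p -> cut_lt p p x.
Proof.
move=> xp; rewrite /cut_lt ltxx; have : th x != th p by apply/eqP => /thI.
by case: ltP => //= ? ?; lra.
Qed.

Lemma cut_lt_total p x y : x <> y -> ~~ cut_lt p x y -> cut_lt p y x.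
Proof.
move=> xy; have : th x != th y by apply/eqP => /thI.
by rewrite /cut_lt; case: ltP => ?; case: ltP => ? //=; lra.
Qed.

Lemma cut_lt_trans p y x z : cut_lt p x y -> cut_lt p y z -> cut_lt p x z.
Proof.
rewrite /cut_lt.
by case: (ltP (th x) (th p)) => ?; case: (ltP (th y) (th p)) => ?;
  case: (ltP (th z) (th p)) => ? //=; lra.
Qed.

Lemma cut_ltxx p x : cut_lt p x x = false.
Proof. by rewrite /cut_lt eqxx ltxx. Qed.

Variable v : nat -> S.
Let lt := cut_lt (v 0%N).

Definition realizes (r : seq nat) := forall i j, (i < size r)%N -> (j < size r)%N ->
  (nth 0%N r i < nth 0%N r j)%N = lt (v i) (v j).

Lemma cyc_evalP r f : realizes r ->
  if cyc_eval r f is Some b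
  then if b then cyc_denote th v f else ~ cyc_denote th v f else True.
Proof.
move=> rr.
have ordP i j k : if cyc_eval_ord r i j k is Some b
    then cc th (v i) (v j) (v k) = b else True.
  rewrite /cyc_eval_ord; case: ifP => // /and3P[ir jr kr].
  by rewrite (cc_cut (v 0%N)) -!/(lt _ _) -!rr // /cyc_nat -orbA.
elim: f => /=.
- by move=> i j k; have := ordP i j k; case: cyc_eval_ord => // -[] ->.
- by move=> i j k; have := ordP i j k; case: cyc_eval_ord => // -[] -> /=.
- move=> i j k i' j' k'; have := ordP i j k; have := ordP i' j' k'.
  by do 2!case: cyc_eval_ord => // ?; move=> -> -> /=; case: eqP.
- move=> i j; case: ifP => // /andP[ir jr].
  case: eqP => [e|/eqP ne h].
    apply: contrapT => ne; have := cut_lt_total (p := v 0%N) ne.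
    by rewrite -!/(lt _ _) -!rr // e ltnn => /(_ isT).
  have := rr _ _ ir jr; have := rr _ _ jr ir; rewrite h /lt cut_ltxx.
  by move: ne; rewrite neq_ltn => /orP[] ->.
- by [].
- by move=> f; case: (cyc_eval r f) => [[]|] //= ? /(_ _).
- by move=> f + g; case: (cyc_eval r f) => [[]|]; case: (cyc_eval r g) => [[]|] //=;
    tauto.
- by move=> f + g; case: (cyc_eval r f) => [[]|]; case: (cyc_eval r g) => [[]|] //=;
    tauto.
- by move=> f + g; case: (cyc_eval r f) => [[]|]; case: (cyc_eval r g) => [[]|] //=;
    tauto.
Qed.

Lemma realizes_old r k : (k < size r)%N -> realizes r -> v (size r) = v k ->
  realizes (rcons r (nth 0%N r k)).
Proof.
move=> kr rr vk i j; rewrite size_rcons !ltnS !nth_rcons.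
have H m : (m <= size r)%N -> exists m', [/\ (m' < size r)%N, v m = v m' &
   (if (m < size r)%N then nth 0%N r m else if m == size r then nth 0%N r k else 0%N) = nth 0%N r m'].
  by rewrite leq_eqVlt => /orP[/eqP ->|mr]; [exists k; rewrite ltnn eqxx|exists m;
    rewrite mr].
by move=> /H[i' [i1 -> ->]] /H[j' [j1 -> ->]]; exact: rr.
Qed.

Lemma shift_above_lt k a b : (shift_above k a < shift_above k b)%N = (a < b)%N.
Proof. by rewrite /shift_above; case: (ltnP k a) => ?; case: (ltnP k b) => ?; lia. Qed.

(* [k] is the predecessor of the new point among the old ones. *)
Lemma realizes_new r k : (k < size r)%N -> realizes r ->
  (forall i, (i < size r)%N -> lt (v i) (v (size r)) = (nth 0 r i <= nth 0 r k)%N) ->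
  (forall i, (i < size r)%N -> v i <> v (size r)) ->
  realizes (rcons (map (shift_above (nth 0%N r k)) r) (nth 0%N r k).+1).
Proof.
move=> kr rr hk hn i j; rewrite size_rcons size_map !ltnS !nth_rcons !size_map.
have gtE m : (m < size r)%N -> lt (v (size r)) (v m) = ~~ lt (v m) (v (size r)).
  move=> mr; apply/idP/idP; last by apply: cut_lt_total; exact: hn.
  by move=> h1; apply/negP => h2; have := cut_lt_trans h1 h2; rewrite cut_ltxx.
have H m : (m <= size r)%N -> m = size r \/ (m < size r)%N by lia.
move=> /H[->|ir] /H[->|jr]; rewrite ?ltnn ?eqxx.
- by rewrite /lt cut_ltxx.
- rewrite jr gtE // hk // (nth_map 0%N) // /shift_above.
  by case: (ltnP (nth 0%N r k) (nth 0%N r j)) => ?; lia.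
- rewrite ir hk // (nth_map 0%N) // /shift_above.
  by case: (ltnP (nth 0%N r k) (nth 0%N r i)) => ?; lia.
- by rewrite ir jr !(nth_map 0%N) // shift_above_lt rr.
Qed.

Lemma realizes_extend r : (0 < size r)%N -> realizes r ->
  exists2 k, k \in r & realizes (rcons r k) \/ realizes (rcons (map
    (shift_above k) r) k.+1).
Proof.
move=> r0 rr.
have [[k [kr vk]]|hn] := pselect (exists k, (k < size r)%N /\ v k = v (size r)).
  by exists (nth 0%N r k); [exact: mem_nth|left; apply: realizes_old].
have hn' i : (i < size r)%N -> v i <> v (size r) by move=> ir vi; apply: hn; exists i.
pose P (i : 'I_(size r)) := lt (v i) (v (size r)).
(* The point [v 0] is the least one after the cut, so a new point always has a predecessor. *)
have P0 : P (Ordinal r0) by apply: cut_lt_min; apply/nesym/hn'.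
have [k Pk kmax] := arg_maxnP (fun i : 'I_(size r) => nth 0%N r i) P0.
exists (nth 0%N r k); first exact: mem_nth.
right; apply: realizes_new => // i ir; apply/idP/idP; first exact: (kmax (Ordinal ir)).
rewrite leqNgt rr // => h; apply: contrapT => /negP /(cut_lt_total (hn' _ ir)).
move=> h'; move: h; rewrite (_ : lt _ _ = true) //.
exact: cut_lt_trans Pk h'.
Qed.

Lemma cyc_searchP n r f : (0 < size r)%N -> realizes r -> cyc_search n r f ->
  cyc_denote th v f.
Proof.
elim: n r => [|n IH] r r0 rr /=; have := cyc_evalP f rr; case:
  (cyc_eval r f) => [[]|] //= _;
  move=> /allP h; have [k kr] := realizes_extend r0 rr; have := h k;
  rewrite mem_undup => /(_ kr) /andP[h1 h2] [] rr';
    first [exact: IH rr' h1|exact: IH rr' h2|idtac];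
  by [apply: IH rr' h1; rewrite size_rcons|apply: IH rr' h2; rewrite size_rcons].
Qed.

End Decision.

(** The search starts with the first variable alone, at rank 0, because the circle is cut at that
    point. *)
Lemma cyc_decide {R : realType} {S : Type} (th : S -> R) (n : nat) (f : cyc_form)
    (x : S) (s : seq S) : injective th ->
  cyc_search n [:: 0%N] f -> cyc_denote th (nth x s) f.
Proof.
move=> thI; apply: cyc_searchP => //.
by move=> [|i] [|j] //= _ _; rewrite ltnn cut_ltxx.
Qed.

Ltac cyc_mem x l :=
  lazymatch l with
  | nil => constr:(false)
  | x :: _ => constr:(true)
  | _ :: ?l => cyc_mem x l
  end.

Ltac cyc_add x l :=
  lazymatch cyc_mem x l with
  | true => l
  | false => let r := eval cbv [rcons] in (rcons l x) in r
  end.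

Ltac cyc_index x l :=
  lazymatch l with
  | x :: _ => constr:(0%N)
  | _ :: ?l => let i := cyc_index x l in constr:(i.+1)
  end.

Ltac cyc_size l :=
  lazymatch l with
  | nil => constr:(0%N)
  | _ :: ?l => let n := cyc_size l in constr:(n.+1)
  end.

Ltac cyc_vars f l :=
  lazymatch f with
  | is_true (cc _ ?a ?b ?c) =>
    let l := cyc_add a l in let l := cyc_add b l in cyc_add c l
  | is_true (~~ cc _ ?a ?b ?c) =>
    let l := cyc_add a l in let l := cyc_add b l in cyc_add c l
  | cc _ ?a ?b ?c = cc _ ?d ?e ?g =>
    let l := cyc_add a l in let l := cyc_add b l in let l := cyc_add c l in
    let l := cyc_add d l in let l := cyc_add e l in cyc_add g l
  | ?a = ?b => let l := cyc_add a l in cyc_add b l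
  | ~ ?f => cyc_vars f l
  | ?f /\ ?g => let l := cyc_vars f l in cyc_vars g l
  | ?f \/ ?g => let l := cyc_vars f l in cyc_vars g l
  | ?f -> ?g => let l := cyc_vars f l in cyc_vars g l
  | False => l
  end.

Ltac cyc_reify f l :=
  lazymatch f with
  | is_true (cc _ ?a ?b ?c) =>
    let i := cyc_index a l in let j := cyc_index b l in let k := cyc_index c l in
    constr:(CycOrd i j k)
  | is_true (~~ cc _ ?a ?b ?c) =>
    let i := cyc_index a l in let j := cyc_index b l in let k := cyc_index c l in
    constr:(CycNOrd i j k)
  | cc _ ?a ?b ?c = cc _ ?d ?e ?g =>
    let i := cyc_index a l in let j := cyc_index b l in let k := cyc_index c l in
    let i' := cyc_index d l in let j' := cyc_index e l in let k' := cyc_index g l in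
    constr:(CycSame i j k i' j' k')
  | ?a = ?b => let i := cyc_index a l in let j := cyc_index b l in constr:(CycEq i j)
  | ~ ?f => let f := cyc_reify f l in constr:(CycNot f)
  | ?f /\ ?g => let f := cyc_reify f l in let g := cyc_reify g l in constr:(CycAnd f g)
  | ?f \/ ?g => let f := cyc_reify f l in let g := cyc_reify g l in constr:(CycOr f g)
  | ?f -> ?g => let f := cyc_reify f l in let g := cyc_reify g l in constr:(CycImp f g)
  | False => constr:(CycFalse)
  end.

Ltac cyc_inj inj :=
  lazymatch type of inj with
  | @injective _ ?S ?th =>
    lazymatch goal with |- ?f =>
      let l := cyc_vars f (@nil S) in
      let f' := cyc_reify f l in
      lazymatch l with ?x :: _ =>
        let n := cyc_size l in
        refine (@cyc_decide _ _ _ n f' x l inj _); vm_compute; reflexivity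
      end
    end
  end.

(** [cyc_vars] fails on hypotheses outside the language of [cyc_form], which therefore stay in the
    context. *)
Ltac cyc_revert inj :=
  lazymatch type of inj with
  | @injective _ ?S _ =>
    repeat match goal with H : ?T |- _ =>
      let l := cyc_vars T (@nil S) in revert H end
  end.

(* [cyc] proves a statement about cyclic order from the explicit premises of
   the goal; [cyc_ctx] also uses the context. *)
Ltac cyc := match goal with H : @injective _ _ _ |- _ => cyc_inj H end.
Ltac cyc_ctx :=
  match goal with H : @injective _ _ _ |- _ => cyc_revert H; cyc_inj H end.

(** * Laminations of a cyclic order *)

Section CyclicOrder.
Context {R : realType} {S : Type} (th : S -> R).

Local Notation cc := (@cc R S th).

Definition cyclic_mono (g : S -> S) := forall a b c, cc (g a) (g b) (g c) = cc a b c.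

Definition dense_cyclic := forall a b : S, a <> b -> exists c, cc a c b.

(* Dedekind completeness of the circle cut at [p]. *)
Definition complete_cyclic := forall (p : S) (A : set S),
  (forall x x', A x -> cc p x' x -> A x') ->
  (exists2 x, x <> p & A x) -> (exists2 x, x <> p & ~ A x) ->
  exists y, [/\ y <> p, forall x, cc p x y -> A x & forall x, cc p y x -> ~ A x].

(** Convergence along [U] in the order topology, whose basic neighbourhoods are the open arcs. *)
Definition order_lim {T : Type} (U : set_system T) (x : T -> S) (p : S) :=
  forall a b, cc a p b -> U [set t | cc a (x t) b].

Hypothesis thI : injective th.

Hypothesis dense : dense_cyclic.
Hypothesis complete : complete_cyclic.

Lemma cyclic_mono_inj g : cyclic_mono g -> injective g.
Proof.
move=> gm x y gxy; apply: contrapT => xy.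
have [c xcy] := dense xy.
by move: (gm x c y) xcy; rewrite gxy; cyc.
Qed.

(** Serves to shrink a neighbourhood of [u] until it avoids a given point [e]; near [u] the order is
    then linear, cut at [e]. *)
Lemma shrink_left e u a : e <> u -> a <> u ->
  exists a', cc e a' u /\ (a' = a \/ cc a a' u).
Proof.
move=> eu au; have [xa|xa] := boolP (cc e a u); first by exists a; split=> //; left.
by have [w wE] := dense eu; exists w; move: xa wE au; cyc.
Qed.

Lemma shrink_right e u b : e <> u -> b <> u ->
  exists b', cc u b' e /\ (b' = b \/ cc u b' b).
Proof.
move=> eu bu; have [xb|xb] := boolP (cc u b e); first by exists b; split=> //; left.
by have [w wE] := dense (nesym eu); exists w; move: xb wE bu; cyc.
Qed.

Lemma closest_left e u a a' : cc e a u -> cc e a' u ->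
  exists c, [/\ cc e c u, ~ cc e c a & ~ cc e c a'].
Proof.
move=> ea ea'; have [aa|aa] := boolP (cc e a a').
  by exists a'; split=> //; move: aa; cyc.
by exists a; split; move: aa ea ea'; cyc.
Qed.

Lemma closest_right e u b b' : cc u b e -> cc u b' e ->
  exists c, [/\ cc u c e, ~ cc u b c & ~ cc u b' c].
Proof.
move=> eb eb'; have [bb|bb] := boolP (cc u b b').
  by exists b; split=> //; move: bb; cyc.
by exists b'; split; move: bb eb eb'; cyc.
Qed.

(* Knaster-Tarski on the closed arc from u to v. *)
Lemma fixed_point_arc k u v : cyclic_mono k -> u <> v ->
  k u = u \/ cc u (k u) v -> k v = v \/ cc u (k v) v -> ~~ cc u (k v) (k u) ->
  exists2 z, k z = z & [\/ z = u, z = v | cc u z v].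
Proof.
move=> km uv [ku|ku]; first by exists u => //; constructor 1.
case=> [kv|kv]; first by exists v => //; constructor 2.
move=> kuv.
have ki := cyclic_mono_inj km.
have kuv' : k u <> k v by move/ki.
(* [A] consists of the points of the arc not beyond some [w] that [k] moves forwards; its supremum
   is the fixed point. *)
pose A z := exists w, [/\ cc u w v, cc u w (k w) & z = w \/ cc u z w].
have Aku : A (k u).
  exists (k u); split=> //; last by left.
  by have := km u (k u) v; move: ku kv kuv kuv' uv; cyc.
have AV : ~ A v by move=> [w []]; cyc.
have [||| y [yu yA yNA]] := complete (p := u) (A := A).
- move=> x x' [w [w1 w2 w3]] x'x; exists w; split=> //; right.
  by move: w1 w2 w3 x'x; cyc.
- by exists (k u) => //; move: ku; cyc.
- by exists v => //; move/esym.
have Ak w : cc u w v -> cc u w (k w) -> A (k w).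
  move=> w1 w2; exists (k w).
  split; [| |by left]; move: (km u w v) (km w (k w) v) ku kv kuv kuv' w1 w2; cyc.
exists y.
  have yv : y = v \/ cc u y v.
    apply: contrapT => h; apply: AV; apply: yA; move: h yu uv; cyc.
  have kyin : cc u (k y) v by have := km u y v; move: ku kv kuv kuv' yu;
    case: yv => [->|]; cyc.
  have ky1 : cc u (k u) (k y) by have := km u y v; move: ku kv kuv kuv' yu;
    case: yv => [->|]; cyc.
  apply: contrapT => kyy.
  have [lt|gt] : cc u (k y) y \/ cc u y (k y) by move: kyin kyy yu; cyc.
    have [w [w1 w2 w3]] := yA _ lt.
    have nkw : ~ cc u y (k w) by move=> /yNA; apply; exact: Ak.
    by have := km u w y; move: nkw w1 w2 w3 kyin ky1 lt ku; cyc.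
  apply: (yNA _ gt); apply: Ak => //.
  by move: kyin gt; cyc.
have : y = v \/ cc u y v.
  apply: contrapT => h; apply: AV; apply: yA; move: h yu uv; cyc.
by case=> ?; [constructor 2|constructor 3].
Qed.

(** * Fixed points as extrema of invariant sets *)

Section InvariantSet.
Variables (g : S -> S) (z0 : S) (E : set S).
Hypotheses (gm : cyclic_mono g) (gs : forall y, exists x, g x = y) (gz0 : g z0 = z0).
Hypotheses (Eg : forall w, E (g w) <-> E w) (Ez0 : ~ E z0).

(** On the circle cut at the fixed point [z0], [g] is an increasing bijection preserving [E], so it
    fixes the supremum of [E]; the bound [x] keeps this supremum away from [z0]. *)
Lemma sup_invariant e x : E e -> x <> z0 -> (forall e, E e -> ~~ cc z0 x e) ->
  exists y, [/\ y <> z0, g y = y, forall e, E e -> ~~ cc z0 y e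
    & forall w, cc z0 w y -> exists2 e, E e & cc z0 w e].
Proof.
move=> Ee xz0 Ex.
have ez0 : e <> z0 by move=> h; apply: Ez0; rewrite -h.
pose A z := exists2 e, E e & cc z0 z e.
have [||| y [yz yA yNA]] := complete (p := z0) (A := A).
- by move=> w w' [f Ef wf] ww; exists f => //; move: wf ww; cyc.
- have [z zp] := dense (nesym ez0); exists z; last by exists e.
  by move: zp; cyc.
- by exists x => // -[f /Ex]; cyc.
have ub f : E f -> ~~ cc z0 y f.
  move=> Ef; apply/negP => yf.
  have [z zp] : exists z, cc y z f by apply: dense; move: yf; cyc.
  by apply: (yNA z); [move: yf zp; cyc|exists f => //; move: yf zp; cyc].
exists y; split=> //.
have gc a b : cc z0 (g a) (g b) = cc z0 a b by rewrite -{1}gz0 gm.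
apply: contrapT => gy.
have gyz : g y <> z0 by rewrite -gz0 => /(cyclic_mono_inj gm).
have [lt|gt] : cc z0 (g y) y \/ cc z0 y (g y) by move: gy gyz yz; cyc.
  have [f Ef gyf] := yA _ lt.
  have [f' f'E] := gs f; rewrite -f'E gc in gyf.
  by move: (ub f'); rewrite -Eg f'E gyf => /(_ Ef).
have [y' y'E] := gs y.
have lt : cc z0 y' y by rewrite -gc y'E.
have [f Ef yf] := yA _ lt.
by have := ub _ (proj2 (Eg _) Ef); rewrite -y'E gc yf.
Qed.

Lemma inf_invariant e x : E e -> x <> z0 -> (forall e, E e -> ~~ cc z0 e x) ->
  exists y, [/\ y <> z0, g y = y, forall e, E e -> ~~ cc z0 e y
    & forall w, cc z0 y w -> exists2 e, E e & cc z0 e w].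
Proof.
move=> Ee xz0 Ex.
have ez0 : e <> z0 by move=> h; apply: Ez0; rewrite -h.
pose A z := forall e, E e -> ~~ cc z0 e z.
have [||| y [yz yA yNA]] := complete (p := z0) (A := A).
- by move=> w w' Aw ww f /Aw; move: ww; cyc.
- by exists x.
- have [z zp] := dense ez0; exists z; first by move: zp; cyc.
  by move=> /(_ _ Ee); move: zp; cyc.
have lb f : E f -> ~~ cc z0 f y.
  move=> Ef; apply/negP => yf.
  have [z zp] : exists z, cc f z y by apply: dense; move: yf; cyc.
  by have := yA z; rewrite /A => /(_ _ _ Ef); move: yf zp; cyc.
have cof w : cc z0 y w -> exists2 e, E e & cc z0 e w.
  move=> /yNA nA; apply: contrapT => h; apply: nA => f Ef.
  by apply/negP => fw; apply: h; exists f.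
exists y; split=> //.
have gc a b : cc z0 (g a) (g b) = cc z0 a b by rewrite -{1}gz0 gm.
apply: contrapT => gy.
have gyz : g y <> z0 by rewrite -gz0 => /(cyclic_mono_inj gm).
have [gt|lt] : cc z0 y (g y) \/ cc z0 (g y) y by move: gy gyz yz; cyc.
  have [f Ef gyf] := cof _ gt.
  have [f' f'E] := gs f; rewrite -f'E gc in gyf.
  by move: (lb f'); rewrite -Eg f'E gyf => /(_ Ef).
have [y' y'E] := gs y.
have gt : cc z0 y y' by rewrite -gc y'E.
have [f Ef yf] := cof _ gt.
by have := lb _ (proj2 (Eg _) Ef); rewrite -y'E gc yf.
Qed.
End InvariantSet.


(** * Limits along ultrafilters *)

Lemma ultrafilter_of_base {I T : Type} (D : set I) (B : I -> set T) :
  D !=set0 -> (forall i, D i -> B i !=set0) ->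
  (forall i j, D i -> D j -> exists2 k, D k & B k `<=` B i `&` B j) ->
  exists2 U : set_system T, UltraFilter U & forall i, D i -> U (B i).
Proof.
move=> D0 B0 BI.
have FF : ProperFilter (filter_from D B).
  by apply: filter_from_proper => //; exact: filter_from_filter.
have [U [UU sub]] := ultraFilterLemma FF.
by exists U => // i Di; apply: sub; exists i.
Qed.

Lemma ultra_or {T : Type} (U : set_system T) (A B C : set T) : UltraFilter U ->
  U C -> C `<=` A `|` B -> U A \/ U B.
Proof.
move=> UU UC CAB; case: (in_ultra_setVsetC A UU) => [|UA]; first by left.
by right; apply: filterS (filterI UC UA) => t [/CAB[]].
Qed.

(** Compactness from completeness: cut at an arbitrary [p] and take the supremum of the [z] that lie
    before [x t] for [U]-many [t]. The limit is [p] itself when no [z <> p], or every one, has this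
    property. *)
Lemma order_lim_exists {T : Type} (U : set_system T) (x : T -> S) :
  UltraFilter U -> exists p, order_lim U x p.
Proof.
move=> UU; have [t _] := @filter_ex _ U _ _ filterT.
set p := x t.
pose A z := U [set s | cc p z (x s)].
have UN B : ~ U (~` B) -> U B by case: (in_ultra_setVsetC B UU).
have [[z1 z1p Az1]|nA] := pselect (exists2 z, z <> p & A z); last first.
  exists p => a b apb; have bp : b <> p by move: apb; cyc.
  have [c bc] : exists c, cc p c b by apply: dense; move: apb; cyc.
  have : U (~` [set s | cc p c (x s)]).
    case: (in_ultra_setVsetC [set s | cc p c (x s)] UU) => // Ac.
    by case: nA; exists c => //; move: bc; cyc.
  by apply: filterS => s /= /negP; move: apb bc; cyc.
have [[z2 z2p Az2]|nA] := pselect (exists2 z, z <> p & ~ A z); last first.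
  exists p => a b apb.
  have : A a by apply: contrapT => h; apply: nA; exists a => //; move: apb; cyc.
  by apply: filterS => s /=; move: apb; cyc.
have [||| y [yp yA yNA]] := complete (p := p) (A := A).
- by move=> z z' + zz; apply: filterS => s /=; move: zz; cyc.
- by exists z1.
- by exists z2.
exists y => a b ayb.
have [a' [a1 a2]] : exists a', cc p a' y /\ (cc a a' y \/ a' = a).
  have [pay|pay] := boolP (cc p a y); first by exists a; split=> //; right.
  have [c pcy] := dense (nesym yp); exists c; split=> //.
  by left; move: pay ayb pcy; cyc.
have Aa := yA _ a1.
have [c [c1 c2]] : exists c, cc p y c /\ cc y c b.
  have [pb|pb] := boolP (cc y p b).
    by have [c yc] := dense yp; exists c; move: yc pb; cyc.
  have [c yc] : exists c, cc y c b by apply: dense; move: ayb; cyc.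
  by exists c; split=> //; move: pb yc yp ayb; cyc.
have : U (~` [set s | cc p c (x s)]).
  case: (in_ultra_setVsetC [set s | cc p c (x s)] UU) => // Ac.
  by case: (yNA _ c1).
apply: filterS2 Aa => s /= + /negP; move: a1 a2 c1 c2 ayb; cyc.
Qed.

Lemma order_lim_unique {T : Type} (U : set_system T) (x : T -> S) p q :
  ProperFilter U -> order_lim U x p -> order_lim U x q -> p = q.
Proof.
move=> UU Up Uq; apply: contrapT => pq.
have [c cp] := dense pq; have [d dp] := dense (nesym pq).
have dpc : cc d p c by move: cp dp; cyc.
have cqd : cc c q d by move: cp dp; cyc.
have [t [/= ]] := filter_ex (filterI (Up _ _ dpc) (Uq _ _ cqd)).
by cyc.
Qed.

(** * Leaves as pairs of points, and groups acting on them *)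

Definition rainbow (lf : S -> S -> Prop) (p : S) := forall a b, cc a p b ->
  exists u v, [/\ lf u v, cc a u p & cc p v b].

Definition closed_leaves (lf : S -> S -> Prop) := forall u v, u <> v ->
  (forall a b c d, cc a u b -> cc c v d ->
    exists x y, [/\ lf x y, cc a x b & cc c y d]) -> lf u v.

(** This is what the dynamical argument uses of a very full lamination system, a leaf being recorded
    by its two ends; very fullness enters through [leaf_point]. *)
Record leaf_relation (lf : S -> S -> Prop) : Prop := LeafRelation {
  leaf_sym : forall u v, lf u v -> lf v u;
  leaf_neq : forall u v, lf u v -> u <> v;
  leaf_unlinked : forall u v x y, lf u v -> lf x y -> ~ (cc u x v /\ cc v y u);
  leaf_closed : closed_leaves lf;
  leaf_nonempty : exists u v, lf u v;
  leaf_point : forall p, (exists v, lf p v) \/ rainbow lf p }.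

Lemma leaf_lim lf {T : Type} (U : set_system T) (x y : T -> S) u v :
  closed_leaves lf -> ProperFilter U -> U [set t | lf (x t) (y t)] ->
  order_lim U x u -> order_lim U y v -> u <> v -> lf u v.
Proof.
move=> lfc UU Ul Ux Uy uv; apply: lfc => // a b c d /Ux + /Uy.
move=> /filterI h /h /(filterI Ul) /filter_ex [t [/= ? [? ?]]].
by exists (x t), (y t).
Qed.

Record homeo_group (G : set (S -> S)) : Prop := HomeoGroup {
  grp_mono : forall g, G g -> cyclic_mono g;
  grp_id : G id;
  grp_comp : forall g h, G g -> G h -> G (g \o h);
  grp_inv : forall g, G g -> exists h, [/\ G h, cancel g h & cancel h g] }.

Lemma grp_inv_fun G : homeo_group G -> exists inv : (S -> S) -> S -> S,
  forall g, G g -> [/\ G (inv g), cancel g (inv g) & cancel (inv g) g].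
Proof.
move=> GG.
have [|inv invP] := @choice _ _ (fun g h => G g -> [/\ G h, cancel g h & cancel h g]).
  move=> g; have [/(grp_inv GG)[h ?]|nG] := pselect (G g); first by exists h.
  by exists id.
by exists inv.
Qed.

Definition invariant_leaves (G : set (S -> S)) (lf : S -> S -> Prop) :=
  forall g u v, G g -> lf u v -> lf (g u) (g v).

Definition cusp (G : set (S -> S)) (p : S) := exists2 g, G g &
  forall z, g z = z <-> z = p.

(** * Cusps, rainbows and fixed points of group elements *)

Section Pants.
Variables (G : set (S -> S)) (L : 'I_3 -> S -> S -> Prop).
Hypotheses (GG : homeo_group G) (LL : forall i, leaf_relation (L i))
  (LG : forall i, invariant_leaves G (L i))
  (Ltrans : forall i j u v, i <> j -> L i u v -> ~ L j u v)
  (Lcusp : forall i j p u v, i <> j -> L i p u -> L j p v -> cusp G p).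

(** A short leaf around [p] and its image under [g] are unlinked, so on the circle cut at [p] its
    two ends move in opposite directions. Then [g] or its inverse maps the long arc between them
    into itself and fixes a point there, other than [p]. *)
Lemma cusp_no_rainbow i p : cusp G p -> ~ rainbow (L i) p.
Proof.
move=> [g Gg gp] rb; have gm := grp_mono GG Gg.
have [h [Gh gK hK]] := grp_inv GG Gg; have hm := grp_mono GG Gh.
have gpp : g p = p by apply/gp.
have hpp : h p = p by rewrite -{1}gpp gK.
have gc a b : cc p (g a) (g b) = cc p a b by rewrite -{1}gpp gm.
have hc a b : cc p (h a) (h b) = cc p a b by rewrite -{1}hpp hm.
have [x xp] : exists x, x <> p.
  have [u [v /(leaf_neq (LL i)) uv]] := leaf_nonempty (LL i).
  have [up|up] := pselect (u = p); last by exists u.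
  by exists v => vp; apply: uv; rewrite up.
have gx : g x <> x by move=> /gp.
have gxp : ~ (g x = p) by rewrite -[X in _ = X]gpp => /(can_inj gK).
have hxp : ~ (h x = p) by rewrite -[X in _ = X]hpp => /(can_inj hK).
have ghx : cc p (h x) x = cc p x (g x) by rewrite -gc hK.
have ghx' : cc p x (h x) = cc p (g x) x by rewrite -gc hK.
(* The leaf is so short that, on the circle cut at [p], the point [x] separates [v] and [g v] from
   [u] and [g u]. *)
have [u [v [uv [u1 u2 u3] [v1 v2 v3]]]] : exists u v, [/\ L i u v,
   [/\ cc p x u, cc p (g x) u & cc p (h x) u] & [/\ cc p v x, cc p v (g x) & cc p v
     (h x)]].
  have [xg|xg] := boolP (cc p x (g x)).
    have [|u [v [uv ? ?]]] := rb (g x) (h x); first by cyc_ctx.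
    by exists u, v; split=> //; split; cyc_ctx.
  have [|u [v [uv ? ?]]] := rb (h x) (g x); first by cyc_ctx.
  by exists u, v; split=> //; split; cyc_ctx.
have fixp k : G k -> k p = p -> cc p v (k v) -> cc p (k u) u -> cc p (k v) (k u) ->
    exists2 z, k z = z & z <> p.
  move=> Gk kp h1 h2 h3.
  have [||||z kz] := fixed_point_arc (k := k) (u := v) (v := u) (grp_mono GG Gk).
  - by apply/nesym/(leaf_neq (LL i) uv).
  - by right; cyc_ctx.
  - by right; cyc_ctx.
  - by cyc_ctx.
  by move=> zuv; exists z => //; case: zuv; move: h1 h2 h3; cyc.
have unl := leaf_unlinked (LL i) uv (LG Gg uv).
have unl' := leaf_unlinked (LL i) uv (leaf_sym (LL i) (LG Gg uv)).
have gux := gc u (h x). have gvx := gc v (h x). rewrite hK in gux gvx.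
have gxu := gc (h x) u. have gxv := gc (h x) v. rewrite hK in gxu gxv.
have guv := gc v u.
have gu : g u <> u by move/gp; cyc_ctx.
have gv : g v <> v by move/gp; cyc_ctx.
have [[h1 h2]|[h1 h2]] : (cc p v (g v) /\ cc p (g u) u) \/ (cc p (g v) v /\ cc p u (g u)).
  by cyc_ctx.
- have [z /gp zp] := fixp _ Gg gpp h1 h2 ltac:(cyc_ctx); exact.
have [|||z hz] := fixp _ Gh hpp.
- by rewrite -gc hK.
- by rewrite -gc hK.
- by rewrite hc; cyc_ctx.
by apply; apply/gp; rewrite -{1}hz hK.
Qed.

Lemma cusp_leaf i p : cusp G p -> exists v, L i p v.
Proof. by move=> pc; case: (leaf_point (LL i) p) => // /(cusp_no_rainbow pc). Qed.

(** The ends of leaves from [p] form a set invariant under a parabolic fixing [p]; an extremum of it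
    other than [p] would be a second fixed point. *)
Lemma cusp_leaves_unbounded i p x : cusp G p -> x <> p ->
  (exists2 e, L i p e & cc p x e) /\ (exists2 e, L i p e & cc p e x).
Proof.
move=> pc xp; have [e pe] := cusp_leaf i pc.
case: pc => g Gg gp; have gm := grp_mono GG Gg.
have [h [Gh gK hK]] := grp_inv GG Gg.
have gpp : g p = p by apply/gp.
have hpp : h p = p by rewrite -{1}gpp gK.
have gs y : exists x, g x = y by exists (h y).
have Eg w : L i p (g w) <-> L i p w.
  split=> [/(LG Gh)|/(LG Gg)]; first by rewrite gK hpp.
  by rewrite gpp.
have Ep : ~ L i p p by move=> /(leaf_neq (LL i)).
split; apply: contrapT => h0.
  have [f pf|y [yp /gp //]] := sup_invariant gm gs gpp Eg Ep pe xp.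
  by apply/negP => xf; apply: h0; exists f.
have [f pf|y [yp /gp //]] := inf_invariant gm gs gpp Eg Ep pe xp.
by apply/negP => xf; apply: h0; exists f.
Qed.

(** A point that is not a cusp is an end of leaves of at most one of the three laminations, hence
    has rainbows in the other two. *)
Lemma non_cusp_rainbows p : ~ cusp G p ->
  exists i j, [/\ i <> j, rainbow (L i) p & rainbow (L j) p].
Proof.
move=> pc.
have H i j : i <> j -> rainbow (L i) p \/ rainbow (L j) p.
  move=> ij; have [[u iu]|] := leaf_point (LL i) p; last by left.
  have [[v jv]|] := leaf_point (LL j) p; last by right.
  by case: pc; exact: Lcusp ij iu jv.
pose i0 : 'I_3 := @Ordinal 3 0 isT; pose i1 : 'I_3 := @Ordinal 3 1 isT.
pose i2 : 'I_3 := @Ordinal 3 2 isT.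
have n01 : i0 <> i1 by move/(congr1 val).
have n12 : i1 <> i2 by move/(congr1 val).
have n02 : i0 <> i2 by move/(congr1 val).
have [r0|r1] := H _ _ n01; first by have [?|?] := H _ _ n12;
  [exists i0, i1|exists i0, i2].
by have [?|?] := H _ _ n02; [exists i0, i1|exists i1, i2].
Qed.

(* The pointwise stabilizer of the fixed points of [g] moves points of the
   component ]x1, x2[ of their complement arbitrarily close to both ends. *)
Definition fix_stab (g : S -> S) : set (S -> S) :=
  [set h | G h /\ forall z, g z = z -> h z = z].

Lemma fix_stab_inv g h : fix_stab g h ->
  exists h', [/\ fix_stab g h', cancel h h' & cancel h' h].
Proof.
move=> [Gh hg]; have [h' [Gh' hK h'K]] := grp_inv GG Gh.
by exists h'; split=> //; split=> // z /hg {1}<-; rewrite hK.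
Qed.

Lemma fix_stab_comp g h k : fix_stab g h -> fix_stab g k -> fix_stab g (h \o k).
Proof.
move=> [Gh hg] [Gk kg]; split; first exact: grp_comp.
by move=> z gz /=; rewrite kg // hg.
Qed.

Record moved_component (g : S -> S) (x1 x2 : S) : Prop := MovedComponent {
  moved_left : g x1 = x1;
  moved_right : g x2 = x2;
  moved_neq : x1 <> x2;
  moved_push : forall e w, cc x1 e x2 -> cc x1 w x2 ->
    exists2 h, fix_stab g h & cc x1 w (h e) }.

(** The ends [x1] and [x2] are the infimum and supremum of the orbit of [y] under [fix_stab g], on
    the circle cut at [p]; an unbounded side gives the end [p]. The orbit cannot be unbounded on
    both sides, since it does not cross the fixed point [q]. *)
Lemma moved_componentP g y p q : G g -> g y <> y -> g p = p -> g q = q -> p <> q ->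
  exists x1 x2, moved_component g x1 x2 /\ cc x1 y x2.
Proof.
move=> Gg gy gp gq pq; have gm := grp_mono GG Gg.
have gG : fix_stab g g by split.
have [g' [g'G gK g'K]] := fix_stab_inv gG.
pose E w := exists2 h, fix_stab g h & w = h y.
have gs z : exists x, g x = z by exists (g' z).
have Eg w : E (g w) <-> E w.
  split=> [[h hG]|[h hG ->]]; last by exists (g \o h) => //; exact: fix_stab_comp.
  by move=> /(congr1 g'); rewrite gK => ->; exists (g' \o h) => //; exact: fix_stab_comp.
have Ep : ~ E p.
  move=> [h hG py]; have [h' [[_ h'g] hK _]] := fix_stab_inv hG.
  by apply: gy; rewrite -(hK y) -py h'g.
have Ey : E y by exists id => //; split=> //; exact: grp_id.
have yp : y <> p by move=> yp; apply: gy; rewrite yp.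
have [x2 [gx2 x2y x2E]] : exists x2, [/\ g x2 = x2, x2 = p \/ cc p y x2 &
    forall w, w <> p -> x2 = p \/ cc p w x2 -> exists2 h, fix_stab g h & cc p w (h y)].
  have [[x xp xE]|nx] := pselect (exists2 x, x <> p & forall e, E e -> ~~ cc p x e).
    have [x2 [x2p gx2 x2E x2c]] := sup_invariant gm gs gp Eg Ep Ey xp xE.
    exists x2; split=> //.
      by right; have := x2E _ Ey; have : y <> x2 by [move=> yx; apply: gy; rewrite yx];
        cyc_ctx.
    by move=> w _ [//|/x2c[_ [h hG ->] ?]]; exists h.
  exists p; split=> //; first by left.
  move=> w wp _; apply: contrapT => nh; apply: nx; exists w => // _ [h hG ->].
  by apply/negP => wh; apply: nh; exists h.
have [x1 [gx1 x1y x1E]] : exists x1, [/\ g x1 = x1, x1 = p \/ cc p x1 y &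
    forall w, w <> p -> x1 = p \/ cc p x1 w -> exists2 h, fix_stab g h & cc p (h y) w].
  have [[x xp xE]|nx] := pselect (exists2 x, x <> p & forall e, E e -> ~~ cc p e x).
    have [x1 [x1p gx1 x1E x1c]] := inf_invariant gm gs gp Eg Ep Ey xp xE.
    exists x1; split=> //.
      by right; have := x1E _ Ey; have : y <> x1 by [move=> yx; apply: gy; rewrite yx];
        cyc_ctx.
    by move=> w _ [//|/x1c[_ [h hG ->] ?]]; exists h.
  exists p; split=> //; first by left.
  move=> w wp _; apply: contrapT => nh; apply: nx; exists w => // _ [h hG ->].
  by apply/negP => wh; apply: nh; exists h.
have hc h a b : fix_stab g h -> cc p (h a) (h b) = cc p a b.
  by move=> [Gh hg]; rewrite -{1}(hg _ gp) (grp_mono GG Gh).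
have qy : q <> y by move=> qy; apply: gy; rewrite -qy.
have x12 : x1 <> x2.
  move=> x12; have x1p : x1 = p by move: x1y x2y; rewrite x12; cyc.
  have [h1 h1G] := x1E q (nesym pq) (or_introl x1p).
  rewrite x12 in x1p; have [h2 h2G] := x2E q (nesym pq) (or_introl x1p).
  have := hc _ y q h1G; have := hc _ q y h2G.
  by rewrite (proj2 h1G _ gq) (proj2 h2G _ gq); cyc.
exists x1, x2; split; last by move: x12 x1y x2y yp; cyc.
split=> // e w ex wx.
have [h1 h1G h1e] : exists2 h, fix_stab g h & cc p (h y) e.
  by apply: x1E; move: x12 x1y x2y yp ex wx; cyc.
have [h2 h2G wh2] : exists2 h, fix_stab g h & cc p w (h y).
  by apply: x2E; move: x12 x1y x2y yp ex wx; cyc.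
have [h1' [h1'G h1K h1'K]] := fix_stab_inv h1G.
exists (h2 \o h1'); first exact: fix_stab_comp.
have h3 : cc p (h2 y) (h2 (h1' e)) by rewrite hc // -{1}(h1K y) hc.
have := grp_mono GG (proj1 (fix_stab_comp h2G h1'G)) x1 e x2.
rewrite (proj2 (fix_stab_comp h2G h1'G) _ gx1) (proj2 (fix_stab_comp h2G h1'G) _ gx2) /=.
by move: h3 h1e wh2 x12 x1y x2y yp ex wx; cyc.
Qed.

Lemma moved_pull g x1 x2 e w : moved_component g x1 x2 ->
  cc x1 e x2 -> cc x1 w x2 -> exists2 h, fix_stab g h & cc x1 (h e) w.
Proof.
move=> mc ex wx; have [h hG ehw] := moved_push mc wx ex.
have [h' [h'G hK _]] := fix_stab_inv hG.
exists h' => //; have := grp_mono GG (proj1 h'G) x1 e (h w).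
by rewrite hK (proj2 h'G _ (moved_left mc)) => ->.
Qed.

Lemma fix_stab_inside g x1 x2 h e : moved_component g x1 x2 -> fix_stab g h ->
  cc x1 e x2 -> cc x1 (h e) x2.
Proof.
move=> mc [Gh hg]; have := grp_mono GG Gh x1 e x2.
by rewrite (hg _ (moved_left mc)) (hg _ (moved_right mc)) => ->.
Qed.

Lemma moved_no_fixed g x1 x2 z : moved_component g x1 x2 -> g z = z -> ~ cc x1 z x2.
Proof.
move=> mc gz zx; have [h [_ hG]] := moved_push mc zx zx.
by rewrite hG //; cyc.
Qed.

(** Leaves from a cusp [x1] enter the component. Elements fixing [x1] push their other ends to [x2],
    and closedness makes [{x1, x2}] a leaf of every lamination, against transversality. *)
Lemma moved_left_not_cusp g x1 x2 : moved_component g x1 x2 -> ~ cusp G x1.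
Proof.
move=> mc x1c; have x12 := moved_neq mc.
have [y yx] := dense x12.
suff H i : L i x1 x2 by apply: (Ltrans (i := 0) (j := 1) _ (H 0) (H 1)) => /(congr1 val).
have yx1 : y <> x1 by move: yx; cyc.
have [_ [e x1e ey]] := cusp_leaves_unbounded i x1c yx1.
apply: (leaf_closed (LL i)) => // a b c d ab cd.
have [w [w1 w2]] : exists w, cc x1 w x2 /\ (w = c \/ cc c w x2).
  by apply: shrink_left; move: yx cd x12; cyc.
have [|h hG wh] := moved_push mc _ w1 (e := e); first by cyc_ctx.
have hx := fix_stab_inside mc hG (e := e).
exists x1, (h e); split=> //; last by move: hx wh w1 w2 cd ey yx; cyc.
by rewrite -{1}(proj2 hG _ (moved_left mc)); exact: LG (proj1 hG) x1e.
Qed.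

Lemma moved_right_not_cusp g x1 x2 : moved_component g x1 x2 -> ~ cusp G x2.
Proof.
move=> mc x2c; have x12 := moved_neq mc.
have [y yx] := dense x12.
suff H i : L i x2 x1 by apply: (Ltrans (i := 0) (j := 1) _ (H 0) (H 1)) => /(congr1 val).
have yx1 : y <> x2 by move: yx; cyc.
have [[e x2e ey] _] := cusp_leaves_unbounded i x2c yx1.
apply: (leaf_closed (LL i)) => // [|c d a b cd ab]; first exact: nesym.
have [w [w1 w2]] : exists w, cc x1 w x2 /\ (w = b \/ cc x1 w b).
  by apply: shrink_right; move: yx ab x12; cyc.
have [|h hG wh] := moved_pull mc _ w1 (e := e); first by cyc_ctx.
have hx := fix_stab_inside mc hG (e := e).
exists x2, (h e); split=> //; last by move: hx wh w1 w2 ab ey yx; cyc.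
by rewrite -{1}(proj2 hG _ (moved_right mc)); exact: LG (proj1 hG) x2e.
Qed.

(** Take a leaf around [x1] and push its end inside the component to [x2]. The other end stays
    between the fixed points [x3] and [x1], so it cannot also tend to [x2], and the limit is a
    leaf. *)
Lemma moved_rainbow_leaf g x1 x2 x3 i : moved_component g x1 x2 -> g x3 = x3 ->
  cc x2 x3 x1 -> rainbow (L i) x1 -> exists v, L i x2 v.
Proof.
move=> mc gx3 x3E rb; have [y yx] := dense (moved_neq mc).
pose B w := [set z : S * S | [/\ L i z.1 z.2, cc x3 z.1 x1, cc x1 w z.2 & cc x1 z.2 x2]].
have [|||U UU UB] := ultrafilter_of_base (D := [set w | cc x1 w x2]) (B := B).
- by exists y.
- move=> w /= wx.
  have [|c [d [cd cx dx]]] := rb x3 y; first by cyc_ctx.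
  have [|h hG wh] := moved_push mc _ wx (e := d); first by cyc_ctx.
  have hx := fix_stab_inside mc hG (e := d).
  exists (h c, h d); split=> //=; [exact: LG (proj1 hG) cd| |by cyc_ctx].
  have := grp_mono GG (proj1 hG) x3 c x1.
  by rewrite (proj2 hG _ gx3) (proj2 hG _ (moved_left mc)) => ->.
- move=> w w' /= wx wx'; have [ww|ww] := boolP (cc x1 w w').
    exists w' => // z [z1 z2 z3 z4]; split; split=> //; by cyc_ctx.
  exists w => // z [z1 z2 z3 z4]; split; split=> //; by cyc_ctx.
have [c Uc] := order_lim_exists fst UU.
have Ux2 : order_lim U snd x2.
  move=> a b ab.
  have [w [w1 w2]] : exists w, cc x1 w x2 /\ (w = a \/ cc a w x2).
    by apply: shrink_left; move: yx ab (moved_neq mc); cyc.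
  by apply: filterS (UB _ w1) => z [_ z1 z2 z3] /=; cyc_ctx.
exists c; apply: (leaf_sym (LL i)).
apply: (leaf_lim (leaf_closed (LL i)) _ _ Uc Ux2).
  by apply: filterS (UB _ yx) => z [].
move=> cx2; have /filterI /(_ (UB _ yx)) : U [set z | cc x1 z.1 x3].
  by apply: Uc; rewrite cx2; cyc_ctx.
by move=> /filter_ex [z [/= ? [_ ? _ _]]]; cyc_ctx.
Qed.

Lemma moved_two_fixed g x1 x2 x3 : moved_component g x1 x2 -> g x3 = x3 ->
  x3 = x1 \/ x3 = x2.
Proof.
move=> mc gx3; apply: contrapT => x3E.
have x3x : cc x2 x3 x1.
  by have := moved_no_fixed mc gx3; have := moved_neq mc; move: x3E; cyc.
have [i [j [ij ri rj]]] := non_cusp_rainbows (moved_left_not_cusp mc).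
have [u iu] := moved_rainbow_leaf mc gx3 x3x ri.
have [v jv] := moved_rainbow_leaf mc gx3 x3x rj.
exact: (moved_right_not_cusp mc) (Lcusp ij iu jv).
Qed.

Lemma three_fixed_points g p q r : G g -> g p = p -> g q = q -> g r = r ->
  p <> q -> p <> r -> q <> r -> forall y, g y = y.
Proof.
move=> Gg gp gq gr pq pr qr y; apply: contrapT => gy.
have [x1 [x2 [mc _]]] := moved_componentP Gg gy gp gq pq.
have := moved_two_fixed mc gp; have := moved_two_fixed mc gq.
by have := moved_two_fixed mc gr; move: pq pr qr; cyc.
Qed.

Lemma cusp_fixed_point g p q : G g -> cusp G p -> g p = p -> g q = q -> p <> q ->
  forall y, g y = y.
Proof.
move=> Gg pc gp gq pq y; apply: contrapT => gy.
have [x1 [x2 [mc _]]] := moved_componentP Gg gy gp gq pq.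
have [px|px] := moved_two_fixed mc gp; move: pc; rewrite px.
  exact: moved_left_not_cusp mc.
exact: moved_right_not_cusp mc.
Qed.

(** * Ends of the leaves from a cusp *)

Lemma last_leaf i p x e : L i p e -> cc p e x ->
  exists t, [/\ L i p t, t = x \/ cc p t x & forall f, L i p f -> ~ cc t f x].
Proof.
move=> pe ex; have [px|px] := pselect (L i p x).
  by exists x; split=> //; [left|move=> f _; cyc].
pose A z := exists f, [/\ L i p f, cc p f x & cc p z f].
have [||| y [yp yA yNA]] := complete (p := p) (A := A).
- by move=> z z' [f [f1 f2 f3]] zz; exists f; split=> //; move: f3 zz; cyc.
- have [z zp] : exists z, cc p z e by apply: dense; move: ex; cyc.
  by exists z; [move: zp; cyc|exists e; split].
- by exists x; [move: ex; cyc|move=> [f [_]]; cyc].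
have ub f : L i p f -> cc p f x -> ~ cc p y f.
  move=> f1 f2 yf; have [z zp] : exists z, cc y z f by apply: dense; move: yf; cyc.
  by apply: (yNA z); [cyc_ctx|exists f; split=> //; cyc_ctx].
(* Ends of leaves from [p] accumulate at the supremum [y], which differs from [p], so closedness
   applies. *)
have py : L i p y.
  apply: (leaf_closed (LL i)) => // [|a b c d ab cd]; first exact: nesym.
  have [w [w1 w2]] : exists w, cc p w y /\ (w = c \/ cc c w y).
    by apply: shrink_left; move: cd yp; cyc.
  have [f [f1 f2 f3]] := yA _ w1; have f4 := ub _ f1 f2.
  by exists p, f; split=> //; move: w1 w2 f3 f4 cd; cyc.
have xy : x <> y by move=> xy; apply: px; rewrite xy.
have yx : ~ cc p x y by move=> /yA [f [_]]; cyc.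
exists y; split=> // [|f /ub]; first by right; cyc_ctx.
by move: yp ex xy yx; cyc.
Qed.

Lemma first_leaf i p x e : L i p e -> cc p x e ->
  exists s, [/\ L i p s, s = x \/ cc p x s & forall f, L i p f -> ~
    (cc p x f /\ cc p f s)].
Proof.
move=> pe ex; have [px|px] := pselect (L i p x).
  by exists x; split=> //; [left|move=> f _; cyc].
pose A z := forall f, L i p f -> cc p x f -> ~ cc p f z.
have [||| y [yp yA yNA]] := complete (p := p) (A := A).
- by move=> z z' Az zz f f1 f2; have := Az f f1 f2; move: zz; cyc.
- by exists x; [move: ex; cyc|move=> f _; cyc].
- have [z zp] : exists z, cc e z p by apply: dense; move: ex; cyc.
  by exists z; [move: zp; cyc|move=> /(_ e pe ex); cyc_ctx].
have lb f : L i p f -> cc p x f -> ~ cc p f y.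
  move=> f1 f2 yf; have [z zp] : exists z, cc f z y by apply: dense; move: yf; cyc.
  by apply: (yA z _ f) => //; cyc_ctx.
have Ay w : cc p y w -> exists f, [/\ L i p f, cc p x f & cc p f w].
  by move=> /yNA nA; apply: contrapT => h; apply: nA => f f1 f2 f3; apply: h; exists f.
have py : L i p y.
  apply: (leaf_closed (LL i)) => // [|a b c d ab cd]; first exact: nesym.
  have [w [w1 w2]] : exists w, cc p y w /\ (w = d \/ cc y w d).
    have [||w [s1 s2]] := @shrink_right p y d; [move: cd yp; cyc..|].
    by exists w; move: s1 s2; cyc.
  have [f [f1 f2 f3]] := Ay _ w1; have f4 := lb _ f1 f2.
  by exists p, f; split=> //; move: w1 w2 f3 f4 cd; cyc.
exists y; split=> // [|f /lb]; last by cyc.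
right; have xy : x <> y by move=> xy; apply: px; rewrite xy.
have : ~ cc p y x by move=> /Ay [f [_]]; cyc.
by cyc_ctx.
Qed.

(* The two closed sets of ends of leaves from [p] in two transverse laminations
   are disjoint, so such gaps between consecutive ends of different types are
   discrete away from [p]. *)
Record cusp_gap (p t s : S) : Prop := CuspGap {
  cusp_gap_left : L 0 p t;
  cusp_gap_right : L 1 p s;
  cusp_gap_lt : cc p t s;
  cusp_gap_empty : forall e, L 0 p e \/ L 1 p e -> ~ cc t e s }.

(** From an end [s0] for [L 1], go back to the last end [t] for [L 0], then forward to the first end
    for [L 1]; transversality keeps the two kinds of ends apart. *)
Lemma cusp_gap_exists p : cusp G p -> exists t s, cusp_gap p t s.
Proof.
move=> pc; have [s0 ps0] := cusp_leaf 1 pc.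
have s0p : s0 <> p by apply/nesym/(leaf_neq (LL 1)).
have L01 e : L 0 p e -> ~ L 1 p e by apply: Ltrans => /(congr1 val).
have [_ [e pe es0]] := cusp_leaves_unbounded 0 pc s0p.
have [t [pt ts0 tN]] := last_leaf pe es0.
have ts : t <> s0 by move=> ts; apply: (L01 t) => //; rewrite ts.
have ts0' : cc p t s0 by case: ts0.
have [s [ps ts' sN]] := first_leaf ps0 ts0'.
have ts1 : s <> t by move=> st; apply: (L01 t) => //; rewrite -st.
have ss0 := sN _ ps0.
exists t, s; split=> //; first by case: ts'.
move=> e' [pe'|pe']; first by have := tN _ pe'; cyc_ctx.
by have := sN _ pe'; cyc_ctx.
Qed.

Lemma cusp_gap_image p t s g : cusp_gap p t s -> G g -> g p = p -> cusp_gap p (g t) (g s).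
Proof.
move=> [pt ps ts N] Gg gp; have [h [Gh gK hK]] := grp_inv GG Gg.
have hp : h p = p by rewrite -{1}gp gK.
split.
- by rewrite -{1}gp; exact: LG.
- by rewrite -{1}gp; exact: LG.
- by rewrite -{1}gp (grp_mono GG Gg).
move=> e pe; rewrite -(hK e) (grp_mono GG Gg); apply: N.
by case: pe => /(LG Gh); rewrite hp; [left|right].
Qed.

Lemma order_lim_cst {T : Type} (U : set_system T) (p : S) : Filter U -> order_lim U
  (fun=> p) p.
Proof. by move=> UU a b apb; apply: filterE. Qed.

Lemma stab_orbit_unbounded p t x : cusp G p -> t <> p -> x <> p ->
  (exists h, [/\ G h, h p = p & cc p x (h t)]) /\
  (exists h, [/\ G h, h p = p & cc p (h t) x]).
Proof.
move=> [g Gg gp] tp xp; have gm := grp_mono GG Gg.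
have [g' [Gg' gK g'K]] := grp_inv GG Gg.
have gpp : g p = p by apply/gp.
have g'p : g' p = p by rewrite -{1}gpp gK.
pose E w := exists h, [/\ G h, h p = p & w = h t].
have gs z : exists x, g x = z by exists (g' z).
have Eg w : E (g w) <-> E w.
  split=> [[h [Gh hp]]|[h [Gh hp ->]]]; last first.
    by exists (g \o h); split=> //=; [exact: grp_comp|rewrite hp].
  move=> /(congr1 g'); rewrite gK => ->.
  by exists (g' \o h); split=> //=; [exact: grp_comp|rewrite hp].
have Ep : ~ E p.
  move=> [h [Gh hp /esym]]; have [h' [_ hK _]] := grp_inv GG Gh.
  by rewrite -[in RHS]hp => /(can_inj hK).
have Et : E t by exists id; split=> //; exact: grp_id.
split; apply: contrapT => nh.
  have [f [h [Gh hp ->]]|y [yp /gp //]] := sup_invariant gm gs gpp Eg Ep Et xp.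
  by apply/negP => xh; apply: nh; exists h.
have [f [h [Gh hp ->]]|y [yp /gp //]] := inf_invariant gm gs gpp Eg Ep Et xp.
by apply/negP => xh; apply: nh; exists h.
Qed.

(** Otherwise [fixed_point_arc], applied to [g] or to its inverse, gives a fixed point between [t]
    and [z], while an element fixing a cusp and another point is trivial. *)
Lemma stab_up g p t z : G g -> cusp G p -> g p = p -> cc p t (g t) -> z <> p ->
  cc p z (g z).
Proof.
move=> Gg pc gp tg zp; have gm := grp_mono GG Gg.
have [h [Gh gK hK]] := grp_inv GG Gg.
have hp : h p = p by rewrite -{1}gp gK.
have gc a b : cc p (g a) (g b) = cc p a b by rewrite -{1}gp gm.
have hc a b : cc p (h a) (h b) = cc p a b by rewrite -{1}hp (grp_mono GG Gh).
have nf y : g y = y -> y = p.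
  move=> gy; apply: contrapT => yp.
  by have := cusp_fixed_point Gg pc gp gy (nesym yp) t; move: tg; cyc.
apply/negPn/negP => zg.
have gzz : g z <> z by move=> /nf.
have gzp : g z <> p by rewrite -[X in _ = X]gp => /(can_inj gK).
have gz : cc p (g z) z by cyc_ctx.
have [tz|tz] := boolP (cc p t z).
  have gtz : cc p (g t) (g z) by rewrite gc.
  have [||||y gy] := fixed_point_arc gm (u := t) (v := z).
  - by move: tz; cyc.
  - by right; move: gtz tg gz tz; cyc.
  - by right; move: gtz tg gz tz; cyc.
  - by move: gtz tg gz tz; cyc.
  by case; move: (nf _ gy) tz; cyc.
have zt : cc p z t by have : z <> t by [move=> zt; move: gz tg; rewrite zt; cyc]; cyc_ctx.
have h1 : cc p z (h z) by rewrite -gc hK.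
have h2 : cc p (h t) t by rewrite -gc hK.
have h3 : cc p (h z) (h t) by rewrite hc.
have [||||y hy] := fixed_point_arc (grp_mono GG Gh) (u := z) (v := t).
- by move: zt; cyc.
- by right; move: h1 h2 h3; cyc.
- by right; move: h1 h2 h3; cyc.
- by move: h1 h2 h3; cyc.
have gy : g y = y by rewrite -{1}hy hK.
by case; move: (nf _ gy) zt; cyc.
Qed.

Lemma stab_down g p t z : G g -> cusp G p -> g p = p -> cc p (g t) t -> z <> p ->
  cc p (g z) z.
Proof.
move=> Gg pc gp tg zp; have [h [Gh gK hK]] := grp_inv GG Gg.
have hp : h p = p by rewrite -{1}gp gK.
rewrite -{2}(gK z); apply: (stab_up (t := g t)) => //; first by rewrite gK.
by rewrite -[X in _ = X]gp => /(can_inj gK).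
Qed.

(** * Sequences in the stabilizer of a cusp *)

Section Sequence.
Context {T : Type} (U : set_system T).
Hypothesis UU : UltraFilter U.

(** The trace along a nonprincipal ultrafilter of a sequence of distinct elements: no single value
    is taken [U]-often. *)
Definition wandering (k : T -> S -> S) :=
  U [set n | G (k n)] /\ forall g, U [set n | k n <> g].

(** If the limit [q] were not [p], the image gaps would have no end inside one another and
    accumulate at [q]. Both their ends would tend to [q], making [{p, q}] a leaf of [L 0] and of
    [L 1]. *)
Lemma stab_orbit_discrete p t s k : cusp G p -> cusp_gap p t s -> wandering k ->
  U [set n | k n p = p] -> order_lim U (k ^~ t) p.
Proof.
move=> pc gap [Gk kw] kp.
have tp : t <> p by have := cusp_gap_lt gap; cyc.
have [q Uq] := order_lim_exists (k ^~ t) UU.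
have [<- //|qp] := pselect (q = p).
have Ugap : U [set n | cusp_gap p (k n t) (k n s)].
  by apply: filterS2 Gk kp => n /= ? ?; exact: cusp_gap_image.
have Upq : L 0 p q.
  apply: (leaf_lim (leaf_closed (LL 0)) _ _ (order_lim_cst _) Uq); last exact: nesym.
  by apply: filterS Ugap => n [].
suff Usq : order_lim U (k ^~ s) q.
  exfalso; apply: (@Ltrans 0 1 p q _ Upq) => [/(congr1 val)//|].
  apply: (leaf_lim (leaf_closed (LL 1)) _ _ (order_lim_cst _) Usq); last exact: nesym.
  by apply: filterS Ugap => n [].
(* Two distinct elements sending [p] to [p] and [t] to [q] would differ by an element fixing a cusp
   and another point. *)
have Une : U [set n | k n t <> q].
  case: (in_ultra_setVsetC [set n | k n t = q] UU) => // Uq'.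
  have [m [Gm [mp mq]]] := filter_ex (filterI Gk (filterI kp Uq')).
  have [n [[Gn nm] [np nq]]] := filter_ex (filterI (filterI Gk (kw (k m)))
    (filterI kp Uq')).
  have [h [Gh mK hK]] := grp_inv GG Gm.
  case: nm; apply/funext => z; rewrite -[LHS]hK; congr (k m _).
  apply: (@cusp_fixed_point (h \o k n) p t) => //; last exact: nesym.
  - exact: grp_comp.
  - by rewrite /= np -{1}mp mK.
  - by rewrite /= nq -mq mK.
move=> a b aqb.
have [a' [a1 a2]] : exists a', cc p a' q /\ (a' = a \/ cc a a' q).
  by apply: shrink_left; move: aqb qp; cyc.
have [b' [b1 b2]] : exists b', cc p q b' /\ (b' = b \/ cc q b' b).
  have [||b' [s1 s2]] := @shrink_right p q b; [move: aqb qp; cyc..|].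
  by exists b'; move: s1 s2; cyc.
have qab : cc a' q b' by move: a1 b1; cyc.
have gapN n m : cusp_gap p (k n t) (k n s) -> cusp_gap p (k m t) (k m s) ->
    cc p (k n t) (k n s) /\ ~ cc (k n t) (k m t) (k n s).
  by move=> [_ _ ? N] [N' _ _ _]; split=> //; apply: N; left.
have [Ur|Ul] : U [set n | cc p q (k n t)] \/ U [set n | cc p (k n t) q].
  apply: (ultra_or _ (filterI Une Ugap)) => n [/= + /cusp_gap_lt].
  have [kn|kn] := pselect (k n t = p); first by rewrite kn; cyc.
  by have [?|?] := boolP (cc p q (k n t)); [left|right; cyc_ctx].
(* Approach from above: a gap that starts between [q] and [k n0 t] ends no later than [k n0 t]. *)
- have [n0 [[/= r0 a0] g0]] := filter_ex (filterI (filterI Ur (Uq _ _ qab)) Ugap).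
  have q'0 : cc a' q (k n0 t) by move: a1 b1 r0 a0; cyc.
  apply: (filterS3 _ _ Ugap Ur (Uq _ _ q'0)) => n gn /= rn qn.
  have [h1 h2] := gapN _ _ gn g0.
  by move: a1 b1 r0 a0 rn qn h1 h2 a2 b2 aqb; cyc.
- have [n0 [[/= r0 a0] g0]] := filter_ex (filterI (filterI Ul (Uq _ _ qab)) Ugap).
  have q'0 : cc (k n0 t) q b' by move: a1 b1 r0 a0; cyc.
  apply: (filterS3 _ _ Ugap Ul (Uq _ _ q'0)) => n gn /= rn qn.
  have q'n : cc (k n t) q b' by move: b1 rn; cyc.
  (* Approach from below: a gap starting between [k n t] and [q] bounds the end [k n s] of the gap
     before it. *)
  have [m [[/= rm am] gm]] := filter_ex (filterI (filterI Ul (Uq _ _ q'n)) Ugap).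
  have [h1 h2] := gapN _ _ gn gm.
  by move: a1 b1 r0 a0 rn qn h1 h2 rm am a2 b2 aqb; cyc.
Qed.

(** Uniform convergence to [a] outside every neighbourhood of [b], along [U] and in terms of
    arcs. *)
Definition collapses (g : T -> S -> S) (a b : S) := forall c d c' d',
  cc c b d -> cc c' a d' -> U [set n | forall z, ~~ cc c z d -> cc c' (g n z) d'].

(** Say that [k n] moves points forwards, and take [h t] before [p] and close to it. The preimage of
    [h t] under [k n] tends to [p] and comes before [h t], so it lies just after [p]. Points away
    from [p] come after this preimage and are sent between [h t] and [p]. *)
Lemma stab_collapses p k : cusp G p -> wandering k -> U [set n | k n p = p] ->
  collapses k p p.
Proof.
move=> pc [Gk kw] kp c d c' d' cpd cpd'.
have [t [s gap]] := cusp_gap_exists pc.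
have tp : t <> p by have := cusp_gap_lt gap; cyc.
have [inv invP] := grp_inv_fun GG.
have inv_lim h : G h -> h p = p -> order_lim U (fun n => inv (k n) (h t)) p.
  move=> Gh hp; apply: (stab_orbit_discrete (k := fun n => inv (k n) \o h) pc gap).
    split; first by apply: filterS Gk => n /= /invP[? _ _]; exact: grp_comp.
    move=> g; case: (in_ultra_setVsetC [set n | inv (k n) \o h = g] UU) => // Ug.
    have [m [/= Gm mg]] := filter_ex (filterI Gk Ug).
    have [n [[/= Gn ng] nm]] := filter_ex (filterI (filterI Gk Ug) (kw (k m))).
    case: nm; have [_ _ hm] := invP _ Gm; have [_ hn _] := invP _ Gn.
    have [h' [_ _ h'K]] := grp_inv GG Gh.
    apply/funext => z; rewrite -[LHS]hm; congr (k m _).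
    have := congr1 (fun f => f (h' (k n z))) mg.
    by rewrite -{1}ng /= h'K hn.
  apply: filterS2 Gk kp => n /= /invP[_ kK _] np.
  by rewrite hp -{1}np kK.
have kc n a b : k n p = p -> G (k n) -> cc p (k n a) (k n b) = cc p a b.
  by move=> np Gn; rewrite -{1}np (grp_mono GG Gn).
have [Uu|Ud] : U [set n | cc p t (k n t)] \/ U [set n | cc p (k n t) t].
  apply: (ultra_or _ (filterI (filterI Gk kp) (kw id))) => n [[/= Gn np] nid].
  apply: contrapT => /not_orP[h1 h2]; apply: nid; apply/funext.
  have [_ kK _] := invP _ Gn.
  apply: (cusp_fixed_point Gn pc np _ (nesym tp)).
  have : k n t <> p by rewrite -[X in _ = X]np => /(can_inj kK).
  by cyc_ctx.
- have [x [xp xc xc']] : exists x, [/\ x <> p, ~~ cc p x c & ~~ cc p x c'].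
    have [cc'|cc'] := boolP (cc p c c'); first by exists c'; split; cyc_ctx.
    by exists c; split; cyc_ctx.
  have [[h [Gh hp xh]] _] := stab_orbit_unbounded pc tp xp.
  have hpd : cc (h t) p d by cyc_ctx.
  apply: (filterS3 _ _ (filterI Gk kp) Uu (inv_lim _ Gh hp _ _ hpd)).
  move=> n [/= Gn np] un vn z zcd; have [_ kK Kk] := invP _ Gn.
  have vp : inv (k n) (h t) <> p by move=> vp; have := Kk (h t); rewrite vp np;
    move: xh; cyc.
  have := stab_up Gn pc np un vp; rewrite Kk => vh.
  have zd : z = d \/ cc p d z by move: zcd cpd; cyc.
  have vz : cc p (inv (k n) (h t)) z by move: vn vh vp hpd zd; cyc.
  have hz : cc p (h t) (k n z) by rewrite -(Kk (h t)) kc.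
  by move: hz cpd cpd' xh xc xc' xp; cyc.
- have [x [xp xc xc']] : exists x, [/\ x <> p, ~~ cc p d x & ~~ cc p d' x].
    have [cc'|cc'] := boolP (cc p d d'); first by exists d; split; cyc_ctx.
    by exists d'; split; cyc_ctx.
  have [_ [h [Gh hp xh]]] := stab_orbit_unbounded pc tp xp.
  have hpd : cc c p (h t) by cyc_ctx.
  apply: (filterS3 _ _ (filterI Gk kp) Ud (inv_lim _ Gh hp _ _ hpd)).
  move=> n [/= Gn np] un vn z zcd; have [_ kK Kk] := invP _ Gn.
  have vp : inv (k n) (h t) <> p by move=> vp; have := Kk (h t); rewrite vp np;
    move: xh; cyc.
  have := stab_down Gn pc np un vp; rewrite Kk => vh.
  have zd : z = c \/ cc p z c by move: zcd cpd; cyc.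
  have vz : cc p z (inv (k n) (h t)) by move: vn vh vp hpd zd; cyc.
  have hz : cc p (k n z) (h t) by rewrite -(Kk (h t)) kc.
  by move: hz cpd cpd' xh xc xc' xp; cyc.
Qed.

(** Composing with the inverse of one [g m] that sends [p] to [c] moves the sequence into the
    stabilizer of [p]. *)
Lemma cusp_hit_collapses g p c : cusp G p -> wandering g -> U [set n | g n p = c] ->
  exists a b, collapses g a b.
Proof.
move=> pc [Gg gw] gp; have [m [/= Gm mp]] := filter_ex (filterI Gg gp).
have [h [Gh mK hK]] := grp_inv GG Gm.
exists c, p => d e d' e' dpe dce.
have kcol : collapses (fun n => h \o g n) p p.
  apply: stab_collapses => //; last first.
    by apply: filterS gp => n /= ->; rewrite -mp mK.
  split; first by apply: (filterS _ Gg) => n /= ?; exact: grp_comp.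
  move=> k; apply: filterS (gw (g m \o k)) => n /= + hk; apply.
  by rewrite -hk; apply/funext => z /=; rewrite hK.
have hc : cc (h d') p (h e') by rewrite -(mK p) mp (grp_mono GG Gh).
apply: filterS (kcol _ _ _ _ dpe hc) => n /= nz z /nz.
by rewrite (grp_mono GG Gh).
Qed.
End Sequence.

(** * Elements close to the identity *)

Lemma cusp_pinned i p x y e1 e2 : L i p e1 -> L i p e2 -> L i x y ->
  cc p e1 e2 -> cc e1 y e2 -> cc e2 x e1 -> x = p.
Proof.
move=> pe1 pe2 xy e12 ey ex; apply: contrapT => xp.
(* A point [x] between [p] and [e1] would make the leaf cross [{p, e1}]; one between [e2] and [p]
   would make it cross [{p, e2}]. *)
have := leaf_unlinked (LL i) pe1 xy.
have := leaf_unlinked (LL i) pe2 (leaf_sym (LL i) xy).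
by move: e12 ey ex xp; cyc.
Qed.

(** The leaf and its image are unlinked and both surround [x], so they are nested, and [k] or its
    inverse maps the short arc between the ends into itself. *)
Lemma rainbow_leaf_fixed i u v k a x b : L i u v -> G k -> cc a x b ->
  cc a u x -> cc x v b -> cc a (k u) x -> cc x (k v) b ->
  exists2 z, k z = z & cc a z b.
Proof.
move=> uv Gk axb au vb aku kvb.
have [h [Gh kK hK]] := grp_inv GG Gk.
have unl := leaf_unlinked (LL i) uv (LG Gk uv).
have unl' := leaf_unlinked (LL i) uv (leaf_sym (LL i) (LG Gk uv)).
have fixp w w' g : G g -> cc a w x -> cc x w' b -> g w = w \/ cc w (g w) w' ->
    g w' = w' \/ cc w (g w') w' -> ~~ cc w (g w') (g w) -> exists2 z, g z = z & cc a z b.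
  move=> Gg aw bw h1 h2 h3.
  have ww : w <> w' by move: axb aw bw; cyc.
  have [z gz zw] := fixed_point_arc (grp_mono GG Gg) ww h1 h2 h3.
  by exists z => //; case: zw; move: axb aw bw; cyc.
have [[h1 h2]|[h1 h2]] : ((k u = u \/ cc u (k u) v) /\ (k v = v \/ cc u (k v) v)) \/
   ((u = k u \/ cc (k u) u (k v)) /\ (v = k v \/ cc (k u) v (k v))).
- by move: axb au vb aku kvb unl unl'; cyc.
- by apply: (fixp u v) => //; move: axb au vb aku kvb h1 h2; cyc.
have [|||z hz az] := fixp (k u) (k v) h Gh aku kvb.
- by rewrite kK.
- by rewrite kK.
- by rewrite !kK; move: axb au vb aku kvb h1 h2; cyc.
by exists z => //; rewrite -{1}hz hK.
Qed.

(** Without cusps every point has a rainbow in [L 0] or [L 1]. Either some arc has only points with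
    rainbows in [L 1], or the points with rainbows in [L 0] are dense. *)
Lemma three_rainbows : (forall p, ~ cusp G p) -> exists i x1 x2 x3,
  [/\ cc x1 x2 x3, rainbow (L i) x1, rainbow (L i) x2 & rainbow (L i) x3].
Proof.
move=> nc.
have L01 x : rainbow (L 0) x \/ rainbow (L 1) x.
  have [[u iu]|] := leaf_point (LL 0) x; last by left.
  have [[v jv]|] := leaf_point (LL 1) x; last by right.
  by case: (nc x); apply: Lcusp iu jv => /(congr1 val).
have [[a [b [ab H]]]|H] := pselect (exists a b, a <> b /\ forall x, cc a x b ->
  rainbow (L 1) x).
  have [x1 ax1] := dense ab.
  have [x2 ax2] : exists x, cc x1 x b by apply: dense; move: ax1; cyc.
  have [x3 ax3] : exists x, cc x2 x b by apply: dense; move: ax2; cyc.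
  exists 1, x1, x2, x3; split; [move: ax1 ax2 ax3; cyc|apply: H..]; move: ax1 ax2 ax3;
    cyc.
have H0 a b : a <> b -> exists2 x, cc a x b & rainbow (L 0) x.
  move=> ab; apply: contrapT => nx; apply: H; exists a, b; split=> // x ax.
  by have [r0|//] := L01 x; case: nx; exists x.
have [a [b /(leaf_neq (LL 0)) ab]] := leaf_nonempty (LL 0).
have [c ac] := dense ab.
have [x1 ax1 r1] : exists2 x, cc a x c & rainbow (L 0) x by apply: H0; move: ac; cyc.
have [x2 ax2 r2] : exists2 x, cc c x b & rainbow (L 0) x by apply: H0; move: ac; cyc.
have [x3 ax3 r3] := H0 _ _ (nesym ab).
by exists 0, x1, x2, x3; split=> //; move: ac ax1 ax2 ax3; cyc.
Qed.

(** Discreteness of [G], with [V] a filter of nontrivial elements tending pointwise to the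
    identity. *)
Lemma no_small_elements (V : set_system (S -> S)) : ProperFilter V -> V G ->
  V [set k | k <> id] -> (forall a z b, cc a z b -> V [set k | cc a (k z) b]) -> False.
Proof.
move=> VV VG Vid Vz.
have nid (k : S -> S) : k <> id -> ~ forall y, k y = y.
  by move=> kid kI; apply: kid; apply/funext.
have [[p pc]|nc] := pselect (exists p, cusp G p).
  have [t [s gap]] := cusp_gap_exists pc.
  have tp : t <> p by have := cusp_gap_lt gap; cyc.
  (* Leaves from [p] on both sides of [t] pin the image of the leaf [{p, t}]: a small [k] must fix
     [p]. *)
  have [[e2 pe2 te2] [e1 pe1 te1]] := cusp_leaves_unbounded 0 pc tp.
  have pts := cusp_gap_lt gap.
  have n1 : cc e1 t e2 by move: te1 te2; cyc.
  have n2 : cc e2 p e1 by move: te1 te2; cyc.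
  have n3 : cc p t s by [].
  have n4 : cc t s p by move: pts; cyc.
  have [k [[Gk /nid kid] [[k1 k2] [k3 k4]]]] := filter_ex (filterI (filterI VG Vid)
    (filterI (filterI (Vz _ _ _ n1) (Vz _ _ _ n2)) (filterI (Vz _ _ _ n3)
      (Vz _ _ _ n4)))).
  rewrite /= in k1 k2 k3 k4.
  have kp : k p = p.
    by apply: (cusp_pinned pe1 pe2 (LG Gk (cusp_gap_left gap))) => //; move: te1 te2; cyc.
  have kt : k t <> t.
    by move=> kt; apply: kid; apply: cusp_fixed_point Gk pc kp kt (nesym tp).
  have [N1 N2 _ _] := cusp_gap_image gap Gk kp.
  (* If [k] moves forwards, [k t] falls inside the gap from [t] to [s]; if backwards, [k s] does. *)
  have [up|dn] : cc p t (k t) \/ cc p (k t) t by move: k3 kt tp; cyc.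
    by apply: (cusp_gap_empty gap (or_introl N1)); move: up k3; cyc.
  have := stab_down Gk pc kp dn (z := s) => ks.
  apply: (cusp_gap_empty gap (or_intror N2)).
  have : cc p (k s) s by apply: ks; move: pts; cyc.
  by move: k4; cyc.
have [i [x1 [x2 [x3 [x123 r1 r2 r3]]]]] := three_rainbows (fun p pc => nc
  (ex_intro _ p pc)).
(* The points [s1], [s2], [s3] bound disjoint arcs, so that the three fixed points found in them are
   distinct. *)
have [s1 xs1] : exists s, cc x1 s x2 by apply: dense; move: x123; cyc.
have [s2 xs2] : exists s, cc x2 s x3 by apply: dense; move: x123; cyc.
have [s3 xs3] : exists s, cc x3 s x1 by apply: dense; move: x123; cyc.
have a1 : cc s3 x1 s1 by move: x123 xs1 xs3; cyc.
have a2 : cc s1 x2 s2 by move: x123 xs1 xs2; cyc.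
have a3 : cc s2 x3 s3 by move: x123 xs2 xs3; cyc.
have VF a x b : cc a x b -> rainbow (L i) x ->
    V [set k | exists2 z, k z = z & cc a z b].
  move=> axb /(_ _ _ axb)[u [v [uv au vb]]].
  apply: (filterS3 _ _ VG (Vz _ _ _ au) (Vz _ _ _ vb)) => k Gk /= ku kv.
  exact: rainbow_leaf_fixed uv Gk axb au vb ku kv.
have [k [[Gk /nid kid] [[z1 kz1 z1E] [[z2 kz2 z2E] [z3 kz3 z3E]]]]] := filter_ex
  (filterI (filterI VG Vid) (filterI (VF _ _ _ a1 r1) (filterI (VF _ _ _ a2 r2)
    (VF _ _ _ a3 r3)))).
apply: kid; apply: (three_fixed_points Gk kz1 kz2 kz3);
  move: x123 a1 a2 a3 xs1 xs2 xs3 z1E z2E z3E; cyc.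
Qed.


(** * The pointwise limit of a sequence and its collapsing *)

Section Limit.
Context {T : Type} (U : set_system T) (g : T -> S -> S) (f : S -> S).
Hypotheses (UU : UltraFilter U) (gw : wandering U g)
  (gf : forall x, order_lim U (g ^~ x) (f x)).

Lemma limit_mono a b c : f a <> f b -> f b <> f c -> f a <> f c ->
  cc a b c -> cc (f a) (f b) (f c).
Proof.
move=> ab bc ac abc; apply: contrapT => fabc.
have [u fu] := dense ac; have [v fv] := dense (nesym bc); have [w fw] := dense (nesym ab).
have facb : cc (f a) (f c) (f b) by move: fabc ab bc ac; cyc.
have uvw : cc u v w by move: facb fu fv fw; cyc.
have na : cc w (f a) u by move: facb fu fw; cyc.
have nb : cc v (f b) w by move: facb fv fw; cyc.
have nc : cc u (f c) v by move: facb fu fv; cyc.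
have [n [[/= na' nb'] [/= nc' Gn]]] := filter_ex
  (filterI (filterI (gf na) (gf nb)) (filterI (gf nc) (proj1 gw))).
have := grp_mono GG Gn a b c.
by move: abc uvw na' nb' nc'; cyc.
Qed.

(* If the limit is injective, the elements [g m ^-1 \o g n] tend to the
   identity along [U * U]. *)
Lemma limit_not_injective : ~ injective f.
Proof.
move=> fI; have [inv invP] := grp_inv_fun GG.
pose V (Q : set (S -> S)) := U [set m | U [set n | Q (inv (g m) \o g n)]].
have VF : ProperFilter V.
  split; first by rewrite /V => /filter_ex [m /= /filter_ex []].
  split; rewrite /V.
  - by apply: filterE => m; apply: filterE.
  - by move=> P Q VP VQ; apply: filterS2 VP VQ => m /=; exact: filterI.
  - by move=> P Q PQ; apply: filterS => m /=; apply: filterS => n /PQ.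
have [Gg gne] := gw.
apply: (no_small_elements VF); rewrite /V.
- apply: (filterS _ Gg) => m /= /invP[Gm _ _]; apply: (filterS _ Gg) => n /= Gn.
  exact: grp_comp.
- apply: (filterS _ Gg) => m /= /invP[Gm _ mK]; apply: filterS (gne (g m)) => n /= + h;
    apply.
  by apply/funext => z; rewrite -[RHS]/(g m (id z)) -h /= mK.
move=> a z b azb.
have fazb : cc (f a) (f z) (f b).
  by apply: limit_mono => // /fI; move: azb; cyc.
have [c ac] : exists c, cc (f a) c (f z) by apply: dense; move: fazb; cyc.
have [d zd] : exists d, cc (f z) d (f b) by apply: dense; move: fazb; cyc.
have [e be] : exists e, cc (f b) e (f a) by apply: dense; move: fazb; cyc.
have na : cc e (f a) c by move: fazb ac zd be; cyc.
have nb : cc d (f b) e by move: fazb ac zd be; cyc.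
have nz : cc c (f z) d by move: fazb ac zd be; cyc.
apply: (filterS3 _ _ Gg (gf na) (gf nb)) => m /= Gm ma mb.
have [Gm' mK' mK] := invP _ Gm.
apply: filterS (gf nz) => n /= nz'.
rewrite -(grp_mono GG Gm) mK.
by move: ma mb nz' fazb ac zd be na nb nz; cyc.
Qed.

(** For distinct [x] and [y], [~~ cc y z x] describes the closed arc from [x] to [y]; the
    convergence to [a] is uniform on it, which the pointwise limit alone does not record. *)
Definition collapsed_arc (a x y : S) := forall c d, cc c a d ->
  U [set n | forall z, ~~ cc y z x -> cc c (g n z) d].

Lemma collapsed_arc_limit a x y z : collapsed_arc a x y -> ~~ cc y z x -> f z = a.
Proof.
move=> col yzx; apply: (order_lim_unique _ (@gf z)) => c d /col.
by apply: filterS => n /= /(_ z yzx).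
Qed.

(** The images of [x] and [y] bound a short arc near [a] that misses a fixed [e <> a]. It is the
    image of one of the two arcs between them, and [U] decides which. *)
Lemma collapsed_arcVor a x y : x <> y -> f x = a -> f y = a ->
  collapsed_arc a x y \/ collapsed_arc a y x.
Proof.
move=> xy fx fy.
have [e ea] : exists e, e <> a.
  by have [xa|xa] := pselect (x = a); [exists y; rewrite -xa; exact: nesym|exists x].
have [c0 ec0] := dense ea; have [d0 ed0] := dense (nesym ea).
have cad : cc c0 a d0 by move: ec0 ed0; cyc.
have Ux : U [set n | cc c0 (g n x) d0] by apply: gf; rewrite fx.
have Uy : U [set n | cc c0 (g n y) d0] by apply: gf; rewrite fy.
have H s t : f s = a -> f t = a -> s <> t -> U [set n | cc e (g n s) (g n t)] ->
    collapsed_arc a s t.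
  move=> fs ft st Ust c d cad'.
  have [c' [c'1 c'2]] : exists c', cc e c' a /\ (c' = c \/ cc c c' a).
    by apply: shrink_left; move: ec0 cad' ea; cyc.
  have [d' [d'1 d'2]] : exists d', cc a d' e /\ (d' = d \/ cc a d' d).
    by apply: shrink_right; move: ed0 cad' ea; cyc.
  have c'ad' : cc c' a d' by move: c'1 d'1; cyc.
  have Us : U [set n | cc c' (g n s) d'] by apply: gf; rewrite fs.
  have Ut : U [set n | cc c' (g n t) d'] by apply: gf; rewrite ft.
  apply: (filterS3 _ _ (filterI (proj1 gw) Ust) Us Ut) => n [/= Gn est] sn tn z tzs.
  have := grp_mono GG Gn t z s; have gI := cyclic_mono_inj (grp_mono GG Gn).
  have [->|zs] := pselect (z = s).
    by move=> _; move: sn c'1 c'2 d'1 d'2 cad'; cyc.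
  have [->|zt] := pselect (z = t).
    by move=> _; move: tn c'1 c'2 d'1 d'2 cad'; cyc.
  have szt : cc s z t by move: tzs zs zt st; cyc.
  move=> _; have szt' : cc (g n s) (g n z) (g n t) by rewrite (grp_mono GG Gn).
  have ecs : cc e c' (g n s) by move: sn c'1 d'1; cyc.
  have etd : cc e (g n t) d' by move: tn c'1 d'1; cyc.
  have czd : cc c' (g n z) d' by move: szt' est ecs etd; cyc.
  by move: czd c'2 d'2 cad'; cyc.
have : U [set n | cc e (g n x) (g n y)] \/ U [set n | cc e (g n y) (g n x)].
  apply: (ultra_or _ (filterI (filterI Ux Uy) (proj1 gw))) => n [[/= nx ny] Gn].
  have : g n x <> g n y by move/(cyclic_mono_inj (grp_mono GG Gn)).
  have [h|h] := boolP (cc e (g n x) (g n y)); [by left|right].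
  by move: h H0 nx ny ec0 ed0; cyc.
by case=> [/H|/H] col; [left|right]; apply: col => //; exact: nesym.
Qed.

Lemma limit_jump_collapses a p y d : cc p y d ->
  (forall x, cc p x y -> f x = a) -> (forall x, cc y x d -> f x <> a) ->
  exists b c, collapses U g b c.
Proof.
move=> pyd fa fna.
have jump i u v : L i u v -> f u = a -> f v <> a -> L i a (f v).
  move=> uv fu fv; rewrite -fu.
  apply: (leaf_lim (leaf_closed (LL i)) _ _ (@gf u) (@gf v)).
    by apply: filterS (proj1 gw) => n /= Gn; exact: LG.
  by rewrite fu; exact: nesym.
have [i [j [ij [u [v [iuv fu fv]]] [u' [v' [juv fu' fv']]]]]] : exists i j, [/\ i <> j,
    exists u v, [/\ L i u v, f u = a & f v <> a] &
    exists u v, [/\ L j u v, f u = a & f v <> a]].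
  have [yc|/non_cusp_rainbows [i [j [ij ri rj]]]] := pselect (cusp G y).
    suff H i : exists u v, [/\ L i u v, f u = a & f v <> a].
      by exists 0, 1; split=> // /(congr1 val).
    have py : p <> y by move: pyd; cyc.
    have dy : d <> y by move: pyd; cyc.
    have [[e ye pe] _] := cusp_leaves_unbounded i yc py.
    have [_ [e' ye' de']] := cusp_leaves_unbounded i yc dy.
    have fe : f e = a by apply: fa; move: pe; cyc.
    have fe' : f e' <> a by apply: fna.
    (* Leaves from the cusp [y] go to both sides of the jump; whatever [f y] is, one of them has
       only one end sent to [a]. *)
    have [fy|fy] := pselect (f y = a); first by exists y, e'.
    by exists e, y; split=> //; exact: leaf_sym.
  have H k : rainbow (L k) y -> exists u v, [/\ L k u v, f u = a & f v <> a].
    move=> /(_ _ _ pyd) [u [v [uv pu vd]]].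
    by exists u, v; split=> //; [exact: fa|exact: fna].
  by exists i, j; split=> //; exact: H.
have ac : cusp G a := Lcusp ij (jump _ _ _ iuv fu fv) (jump _ _ _ juv fu' fv').
(* Leaves from [a] on both sides of [f v] pin [g n u], which is close to [a], to [a] itself. *)
have [[e2 ae2 ve2] [e1 ae1 ve1]] := cusp_leaves_unbounded i ac fv.
have Uu : U [set n | g n u = a].
  have nv : cc e1 (f v) e2 by move: ve1 ve2; cyc.
  have nu : cc e2 (f u) e1 by rewrite fu; move: ve1 ve2; cyc.
  apply: (filterS3 _ _ (proj1 gw) (gf nu) (gf nv)) => n /= Gn un vn.
  by apply: (cusp_pinned ae1 ae2 (LG Gn iuv)) => //; move: ve1 ve2; cyc.
have uc : cusp G u.
  have [n [/= Gn nu]] := filter_ex (filterI (proj1 gw) Uu).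
  have [h [Gh nK hK]] := grp_inv GG Gn; have [k Gk kf] := ac.
  (* Conjugating a parabolic at [a] by [g n] gives one at [u]. *)
  exists (h \o (k \o g n)).
    by apply: grp_comp => //; exact: grp_comp.
  move=> z /=; split=> [/(congr1 (g n))|->].
    by rewrite hK => /kf; rewrite -nu => /(can_inj nK).
  by rewrite nu (proj2 (kf a)) // -nu nK.
exact: cusp_hit_collapses uc gw Uu.
Qed.

(** Since [f] is not injective, some arc from [p] collapses to [a]; extend it to its supremum [y].
    Past [y], either [f] is [a] up to [p], and the arcs on both sides of [y] collapse, or [f] avoids
    [a] just after [y], which is a jump. If nothing stops the extension, the exceptional point is
    [p]. *)
Lemma limit_collapses : exists a b, collapses U g a b.
Proof.
have [p [q [a [pq fp fq]]]] : exists p q a, [/\ p <> q, f p = a & f q = a].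
  apply: contrapT => H; apply: limit_not_injective => x y xy; apply: contrapT => nxy.
  by apply: H; exists x, y, (f y).
wlog col : p q pq fp fq / collapsed_arc a p q.
  move=> H; have [|col] := collapsed_arcVor pq fp fq; first exact: H.
  exact: H (nesym pq) fq fp col.
pose A z := z <> p /\ collapsed_arc a p z.
have A0 x x' : A x -> cc p x' x -> A x'.
  move=> [xp cx] x'x; split; first by move: x'x; cyc.
  move=> c d /cx; apply: filterS => n /= H z zx; apply: H.
  by move: x'x zx; cyc.
have [[x1 x1p nx1]|nA] := pselect (exists2 x, x <> p & ~ A x); last first.
  exists a, p => c d c' d' cpd cad.
  have [_ /(_ _ _ cad)] : A c by apply: contrapT => h; apply: nA; exists c => //;
    move: cpd; cyc.
  by apply: filterS => n /= H z zc; apply: H; move: cpd zc; cyc.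
have [||y [yp yA yNA]] := complete A0.
- by exists q; [exact: nesym|split=> //; exact: nesym].
- by exists x1.
have fpy x : cc p x y -> f x = a.
  by move=> /yA [xp cx]; apply: (collapsed_arc_limit cx); cyc.
have col' x : cc p y x -> f x = a -> collapsed_arc a x p.
  move=> yx fx; have xp : p <> x by move: yx; cyc.
  have [cx|//] := collapsed_arcVor xp fp fx.
  by case: (yNA _ yx); split=> //; exact: nesym.
have [[d yd fd]|nd] := pselect (exists2 d, cc p y d & f d <> a).
  apply: (limit_jump_collapses (p := p) (y := y) (d := d) yd fpy) => x yx fx.
  have px : cc p y x by move: yx yd; cyc.
  by apply: fd; apply: (collapsed_arc_limit (col' _ px fx)); move: yx yd; cyc.
exists a, y => c d c' d' cyd cad.
have [e [e1 e2]] : exists e, cc p e y /\ (e = c \/ cc c e y).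
  by apply: shrink_left; move: cyd yp; cyc.
have [e' [e'1 e'2]] : exists e', cc p y e' /\ (e' = d \/ cc y e' d).
  have [||e' [s1 s2]] := @shrink_right p y d; [move: cyd yp; cyc..|].
  by exists e'; move: s1 s2; cyc.
have [_ ce] := yA _ e1.
have ce' : collapsed_arc a e' p.
  by apply: col' => //; apply: contrapT => h; apply: nd; exists e'.
apply: filterS2 (ce _ _ cad) (ce' _ _ cad) => n /= H1 H2 z zcd.
have [h|h] := boolP (cc e z p); last exact: H1.
by apply: H2; move: h zcd e1 e2 e'1 e'2 cyd; cyc.
Qed.

End Limit.

Lemma wandering_collapses {T : Type} (U : set_system T) (g : T -> S -> S) :
  UltraFilter U -> wandering U g -> exists a b, collapses U g a b.
Proof.
move=> UU gw.
have [f gf] := choice (fun x => order_lim_exists (fun n => g n x) UU).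
exact: (limit_collapses UU gw gf).
Qed.

End Pants.

End CyclicOrder.

(** * The cyclic order of the circle *)

Section Angle.
Context {R : realType}.
Implicit Types (t s : R) (u v p : circle R).

Lemma cisD s t : cis (s + t) = cis s * cis t.
Proof. by rewrite /cis cosD sinD; simpc; congr Complex; ring. Qed.

Lemma cisD2pi t : cis (t + 2 * pi) = cis t :> R[i].
Proof. by rewrite /cis mulr_natl cosD2pi sinD2pi. Qed.

Lemma norm_cis t : `|cis t| = 1 :> R[i].
Proof. by rewrite normc_def /= cos2Dsin2 sqrtr1. Qed.

Definition point t : circle R := exist _ (cis t : R[i]^o) (mem_set (norm_cis t)).

Lemma cis_inj s t : 0 <= s < 2 * pi -> 0 <= t < 2 * pi -> cis s = cis t -> s = t.
Proof.
wlog st : s t / s <= t.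
  by move=> H s2 t2 e; have [/H|/ltW/H h] := leP s t; [exact|rewrite h].
move=> /andP[s0 s2] /andP[t0 t2] [cst sst].
(* Equal points force [cos (2 h) = 1], hence [sin h = 0], while [h] lies strictly between 0 and
   pi. *)
apply: contrapT => nst; pose h := (t - s) / 2.
have h0 : 0 < sin h.
  have st' : s < t by rewrite lt_neqAle st andbT; apply/eqP.
  by apply: sin_gt0_pi; rewrite /h; apply/andP; split; lra.
have : cos (t - s) = 1.
  by rewrite cosB -cst -sst -!expr2 cos2Dsin2.
rewrite (_ : t - s = h *+ 2); last by rewrite /h -mulr_natr divfK.
rewrite cos_mulr2n => ch.
have := cos2Dsin2 h; have : 0 < sin h ^+ 2 by rewrite exprn_gt0.
by move: ch; rewrite mulr2n; lra.
Qed.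

Lemma cis_surj (z : R[i]) : `|z| = 1 -> exists2 t, 0 <= t < 2 * pi & z = cis t.
Proof.
case: z => a b; rewrite normc_def /= => -[/(congr1 (fun x => x ^+ 2))].
rewrite expr1n sqr_sqrtr ?addr_ge0 ?sqr_ge0 // => ab1.
have a1 : -1 <= a <= 1.
  by have := sqr_ge0 b; rewrite -ler_norml -(@expr_le1 _ 2) // real_normK ?num_real //;
    lra.
have ca : cos (acos a) = a by rewrite acosK // in_itv.
have sa : sin (acos a) = `|b|.
  by rewrite sin_acos // -ab1 addrAC subrr add0r sqrtr_sqr.
have t0 := acos_ge0 a1; have tp := acos_lepi a1; have p0 := @pi_gt0 R.
have [b0|b0] := leP 0 b.
  exists (acos a); first by apply/andP; split; lra.
  by rewrite /cis ca sa ger0_norm.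
exists (2 * pi - acos a).
  apply/andP; split; first by lra.
  suff : 0 < acos a by lra.
  rewrite lt_neqAle t0 andbT; apply/eqP => h.
  move: sa; rewrite -h sin0 => /esym/normr0_eq0 h'.
  by move: b0; rewrite h' ltxx.
by rewrite addrC cisD2pi /cis cosN sinN ca sa ltr0_norm // opprK.
Qed.

Lemma angle_exists u : exists t, (0 <= t < 2 * pi) && (cis t == val u).
Proof.
have [t t2 e] := cis_surj (set_valP u); exists t; rewrite t2 /=.
by apply/eqP; rewrite -e.
Qed.

Lemma angle_sig : {f : circle R -> R | forall u, 0 <= f u < 2 * pi /\ cis (f u) = val u}.
Proof.
exists (fun u => xchoose (angle_exists u)) => u.
by have /andP[? /eqP] := xchooseP (angle_exists u).
Qed.

Definition angle : circle R -> R := sval angle_sig.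

Lemma angle_itv u : 0 <= angle u < 2 * pi.
Proof. exact: (svalP angle_sig u).1. Qed.

Lemma cis_angle u : cis (angle u) = val u.
Proof. exact: (svalP angle_sig u).2. Qed.

Lemma mul_cis u s : val u * cis s = cis (angle u + s) :> R[i].
Proof. by rewrite cisD cis_angle. Qed.

Lemma angle_inj : injective angle.
Proof. by move=> u v e; apply: val_inj; rewrite /= -!cis_angle e. Qed.

Lemma angle_unique u t : 0 <= t < 2 * pi -> val u = cis t -> angle u = t.
Proof. by move=> t2 e; apply: cis_inj => //; [exact: angle_itv|rewrite cis_angle]. Qed.

Lemma angle_shift u v s : 0 <= s < 2 * pi -> val v = val u * cis s :> R[i] ->
  angle v = angle u + s \/ angle v = angle u + s - 2 * pi.
Proof.
move=> s2; rewrite mul_cis => e; have u2 := angle_itv u.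
have [h|h] := ltP (angle u + s) (2 * pi).
  by left; apply: angle_unique => //; apply/andP; split; lra.
right; apply: angle_unique; first by apply/andP; split; lra.
by rewrite e -[in RHS]cisD2pi subrK.
Qed.

(** The disjuncts of [cc] tell where the path from [u] to [v] passes the angle 0: nowhere, before
    [p], or after [p]. *)
Lemma ccwE u p v : ccw u p v = cc angle u p v :> Prop.
Proof.
apply/propext; have := angle_itv u; have := angle_itv p; have := angle_itv v.
move=> v2 p2 u2; split.
  move=> [s [t [[s0 st t2] [ep ev]]]].
  have [||hp] := angle_shift (s := s) _ ep; first by apply/andP; split; lra.
    have [||hv] := angle_shift (s := t) _ ev; first by apply/andP; split; lra.
      by rewrite /cc; lra.
    by rewrite /cc; lra.
  have [||hv] := angle_shift (s := t) _ ev; first by apply/andP; split; lra.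
    by rewrite /cc; lra.
  by rewrite /cc; lra.
have H w s : s = angle w - angle u \/ s = angle w - angle u + 2 * pi ->
    val w = val u * cis s :> R[i].
  move=> h; rewrite mul_cis -cis_angle.
  by case: h => ->; [congr cis; lra|rewrite -[LHS]cisD2pi; congr cis; lra].
move=> /or3P[]/andP[h1 h2].
- exists (angle p - angle u), (angle v - angle u).
  by split; [split; lra|split; apply: H; left].
- exists (angle p - angle u + 2 * pi), (angle v - angle u + 2 * pi).
  by split; [split; lra|split; apply: H; right].
- exists (angle p - angle u), (angle v - angle u + 2 * pi).
  by split; [split; lra|split; apply: H; [left|right]].
Qed.

Lemma angle_point t : 0 <= t < 2 * pi -> angle (point t) = t.
Proof. by move=> t2; apply: angle_unique. Qed.

(** Countability lets a union over all points of an arc be written as the union of a sequence. *)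
Lemma countably_dense_circle : exists q : nat -> circle R,
  forall a b, a <> b -> exists n, cc angle a (q n) b.
Proof.
(* Points of rational angle; a code of no rational gives the angle 0. *)
exists (fun n => point (ratr (odflt 0 (unpickle n)))) => a b ab.
have [x [y [xy x0 y2 H]]] : exists x y, [/\ x < y, 0 <= x, y <= 2 * pi &
    forall t, x < t < y -> 0 <= t < 2 * pi -> cc angle a (point t) b].
  have /andP[a0 a2] := angle_itv a; have /andP[b0 b2] := angle_itv b.
  have [lab|lba] := ltP (angle a) (angle b).
    exists (angle a), (angle b); split=> //; first exact: ltW.
    by move=> t txy t2; rewrite /cc angle_point //; lra.
  have lba' : angle b < angle a.
    by rewrite lt_neqAle lba andbT; apply/eqP => /angle_inj /esym.
  exists (angle a), (2 * pi); split=> //.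
  by move=> t txy t2; rewrite /cc angle_point //; lra.
have [r] := rat_in_itvoo xy; rewrite in_itv /= => rxy.
exists (pickle r); rewrite pickleK /=; apply: H => //.
by move/andP: rxy => [? ?]; apply/andP; split; lra.
Qed.

Lemma dense_circle : dense_cyclic angle.
Proof.
by move=> a b; have [q qP] := countably_dense_circle => /qP[n ?]; exists (q n).
Qed.

Lemma rotate_exists u v : u <> v ->
  exists2 s, 0 < s < 2 * pi & val v = val u * cis s :> R[i].
Proof.
move=> uv; have := angle_itv u; have := angle_itv v => v2 u2.
have [luv|lvu] := ltP (angle u) (angle v).
  exists (angle v - angle u); first by apply/andP; split; lra.
  by rewrite mul_cis -cis_angle; congr cis; lra.
have lvu' : angle v < angle u.
  by rewrite lt_neqAle lvu andbT; apply/eqP => /angle_inj /esym.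
exists (angle v - angle u + 2 * pi); first by apply/andP; split; lra.
by rewrite mul_cis -cis_angle -[LHS]cisD2pi; congr cis; lra.
Qed.

Lemma rotate_point u s : exists v, val v = val u * cis s :> R[i].
Proof. by exists (point (angle u + s)); rewrite mul_cis. Qed.

Lemma rotate_unique u s t : 0 < s < 2 * pi -> 0 < t < 2 * pi ->
  val u * cis s = val u * cis t :> R[i] -> s = t.
Proof.
move=> s2 t2; rewrite !mul_cis => e.
apply: cis_inj; [by apply/andP; split; lra|by apply/andP; split; lra|].
by rewrite -(addKr (angle u) s) -(addKr (angle u) t) [LHS]cisD [RHS]cisD e.
Qed.

Lemma complete_circle : complete_cyclic angle.
Proof.
move=> p A A0 [x xp Ax] [x' x'p nAx'].
(* Angles of rotation from [p] identify the circle minus [p] with the interval from 0 to [2 * pi],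
   where [A] becomes an initial segment with a supremum. *)
pose D := [set s | 0 < s < 2 * pi /\ exists2 y, A y & val y = val p * cis s :> R[i]].
have [s s2 es] := rotate_exists (nesym xp).
have [s' s'2 es'] := rotate_exists (nesym x'p).
have cutE y z a b : 0 < a -> a < b -> b < 2 * pi -> val y = val p * cis a :> R[i] ->
    val z = val p * cis b :> R[i] -> cc angle p y z.
  by move=> a0 ab b2 ya zb; rewrite -ccwE; exists a, b.
have Dub a : D a -> a < s'.
  move=> [+ [y Ay ya]] => /andP[a0 a2]; rewrite ltNge; apply/negP => sa.
  apply: nAx'; have [e|sa'] := eqVneq s' a.
    by rewrite (_ : x' = y) //; apply: val_inj; rewrite /= es' e -ya.
  apply: A0 Ay _; apply: cutE es' ya => //; first by lra.
  by rewrite lt_neqAle sa'.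
have Ds : D s by split=> //; exists x.
have Dsup : has_sup D by split; [exists s|exists s' => a /Dub/ltW].
have supD a : D a -> a <= sup D by move=> /(sup_upper_bound Dsup).
have supl : sup D <= s' by apply: ge_sup; [exists s|move=> a /Dub/ltW].
have sup0 : 0 < sup D < 2 * pi by have ? := supD _ Ds; apply/andP; split; lra.
have [y ey] := rotate_point p (sup D).
exists y; split.
- move=> yp; have e : val p * cis 0 = val p * cis (sup D) :> R[i].
    by rewrite -ey yp /cis cos0 sin0 mulr1.
  move: e; rewrite !mul_cis => e.
  have : 0 = sup D.
    apply: cis_inj; [by apply/andP; split; lra|by apply/andP; split; lra|].
    by rewrite -(addKr (angle p) 0) -(addKr (angle p) (sup D)) [LHS]cisD [RHS]cisD e.
  by lra.
- move=> z; rewrite -ccwE => -[a [b [[a0 ab b2] [za yb]]]].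
  have bE : b = sup D.
    by apply: (@rotate_unique p) => //; [apply/andP; split; lra|rewrite -yb -ey].
  rewrite bE in ab; have [c [c2 [w Aw wc]] ac] := sup_gt Dsup.1 ab.
  by apply: A0 Aw _; apply: cutE za wc => //; lra.
move=> z; rewrite -ccwE => -[a [b [[a0 ab b2] [ya zb]]]] Az.
have aE : a = sup D.
  by apply: (@rotate_unique p) => //; [apply/andP; split; lra|rewrite -ya -ey].
have : b <= sup D by apply: supD; split; [apply/andP; split; lra|exists z].
by lra.
Qed.

End Angle.

(** * Lamination systems *)

Section Arcs.
Context {R : realType}.
Let angI := @angle_inj R.
Local Notation cc := (@cc R (circle R) angle).
Implicit Types u v x y p : circle R.

Lemma in_arc u v p : arc u v p = cc u p v :> Prop.
Proof. exact: ccwE. Qed.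

Lemma arc_inj u v u' v' : u <> v -> u' <> v' -> arc u v = arc u' v' ->
  u = u' /\ v = v'.
Proof.
move=> uv uv' e.
have E x : cc u x v = cc u' x v'.
  by apply/idP/idP; rewrite -!in_arc e.
have [w uw] := dense_circle uv.
by move: uw (E w) (E u) (E u') (E v) (E v') uv uv'; cyc.
Qed.

Lemma dual_arc u v : u <> v -> dual (arc u v) = arc v u.
Proof.
move=> uv; apply/seteqP; split=> p; last by exists u, v.
by move=> [u' [v' [uv' /(arc_inj uv uv')[-> ->]]]].
Qed.

Lemma image_arc (g : circle R -> circle R) (h : circle R -> circle R) u v :
  cyclic_mono angle g -> cancel h g -> g @` arc u v = arc (g u) (g v).
Proof.
move=> gm hK; apply/seteqP; split=> [_ [x + <-]|x].
  by rewrite !in_arc gm.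
by rewrite in_arc -{1}(hK x) gm -in_arc => ?; exists (h x).
Qed.

End Arcs.

Section Lamination.
Context {R : realType} (L : set (set (circle R))).
Hypothesis lamL : lamination_system L.
Let angI := @angle_inj R.
Local Notation cc := (@cc R (circle R) angle).
Implicit Types u v x y p : circle R.

Definition is_leaf u v := u <> v /\ L (arc u v).

Lemma lamination_arc I : L I -> exists u v, is_leaf u v /\ I = arc u v.
Proof.
have [[_ Lo] _ _ _] := lamL.
by move=> LI; have [u [v [uv IE]]] := Lo _ LI; exists u, v; rewrite /is_leaf -IE.
Qed.

Lemma is_leaf_sym u v : is_leaf u v -> is_leaf v u.
Proof.
have [_ Ld _ _] := lamL.
by move=> [uv /Ld]; rewrite dual_arc //; split=> //; exact: nesym.
Qed.

(** If the leaves crossed, each side of the first would contain an end of the second and so lie on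
    neither of its sides. *)
Lemma is_leaf_unlinked u v x y : is_leaf u v -> is_leaf x y -> ~ (cc u x v /\ cc v y u).
Proof.
have [_ _ Ll _] := lamL.
move=> [uv Luv] [xy Lxy] [uxv vyu].
have := Ll _ _ Luv Lxy; rewrite (dual_arc xy).
case=> -[I /= IE sub].
all: suff : I x \/ I y by case=> /sub; rewrite in_arc; cyc.
all: by case: IE => ->; rewrite ?dual_arc // !in_arc; [left|right].
Qed.

(* Arcs of the lamination containing [m] and missing [u0] and [v0] form a chain. *)
Lemma union_leaf u0 v0 m : u0 <> v0 -> cc u0 m v0 ->
  (forall x, cc u0 x v0 -> exists u v,
    [/\ is_leaf u v, ~~ cc u u0 v, ~~ cc u v0 v, cc u m v & cc u x v]) ->
  is_leaf u0 v0.
Proof.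
move=> uv0 m0 H; split=> //.
have [q qP] := @countably_dense_circle R.
pose good z := [/\ is_leaf z.1 z.2, ~~ cc z.1 u0 z.2, ~~ cc z.1 v0 z.2 & cc z.1 m z.2].
have [F FP] : {F : nat -> circle R * circle R & forall n, good (F n) /\
    (cc u0 (q n) v0 -> cc (F n).1 (q n) (F n).2)}.
  apply: (@choice _ _ (fun n z => good z /\ (cc u0 (q n) v0 -> cc z.1 (q n) z.2))) => n.
  have [qn|qn] := boolP (cc u0 (q n) v0).
    by have [u [v [h1 h2 h3 h4 h5]]] := H _ qn; exists (u, v).
  by have [u [v [h1 h2 h3 h4 _]]] := H _ m0; exists (u, v).
pose inside (z w : circle R * circle R) := ~~ cc z.1 w.1 z.2 /\ ~~ cc z.1 w.2 z.2.
have sub z w x : good z -> good w -> inside z w -> cc z.1 x z.2 -> cc w.1 x w.2.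
  move=> [_ z2 z3 z4] [_ w2 w3 w4] [h1 h2] h3.
  by move: z4 w4 z2 w2 h1 h2 h3; cyc.
have chain z w : good z -> good w -> ~ inside z w -> inside w z.
  move=> [lz z2 z3 z4] [lw w2 w3 w4] h; rewrite /inside.
  have := is_leaf_unlinked lz lw; have := is_leaf_unlinked lz (is_leaf_sym lw).
  have := lz.1; have := lw.1.
  have {}h : ~ (~~ cc z.1 w.1 z.2 /\ ~~ cc z.1 w.2 z.2) := h.
  by move: m0 z4 w4 z2 w2 z3 w3 h; cyc.
(* [J n] is the largest of [F 0], ..., [F n], which makes the sequence of arcs increasing. *)
pose J := fix J n := if n is n'.+1
  then if `[< inside (J n') (F n) >] then F n else J n' else F 0%N.
have JP n : good (J n).
  elim: n => [|n IH] /=; first exact: (FP _).1.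
  by case: asboolP => // _; exact: (FP _).1.
have JS n x : cc (J n).1 x (J n).2 -> cc (J n.+1).1 x (J n.+1).2.
  by move=> /=; case: asboolP => // /(sub _ _ x (JP n) (FP n.+1).1).
have JF n x : cc (F n).1 x (F n).2 -> cc (J n).1 x (J n).2.
  case: n => // n /=; case: asboolP => // /(chain _ _ (JP n) (FP n.+1).1).
  exact: sub (FP n.+1).1 (JP n).
have JM n k x : (n <= k)%N -> cc (J n).1 x (J n).2 -> cc (J k).1 x (J k).2.
  by elim: k => [|k IH]; [case: n|rewrite leq_eqVlt => /orP[/eqP -> //|/IH h /h /JS]].
have [_ _ _ Lu] := lamL.
have E : \bigcup_n arc (J n).1 (J n).2 = arc u0 v0.
  apply/seteqP; split=> [x [n _]|x].
    rewrite !in_arc; have [_ j2 j3 j4] := JP n.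
    by move: m0 j2 j3 j4; cyc.
  rewrite in_arc => ux.
  (* An arc that contains points of [q] on both sides of [x] and misses [u0] and [v0] contains
     [x]. *)
  have [i ui] : exists i, cc u0 (q i) x by apply: qP; move: ux; cyc.
  have [j xj] : exists j, cc x (q j) v0 by apply: qP; move: ux; cyc.
  exists (maxn i j) => //; rewrite in_arc; have [_ j2 j3 _] := JP (maxn i j).
  have hi := JM _ _ _ (leq_maxl i j) (JF _ _ ((FP i).2 _)).
  have hj := JM _ _ _ (leq_maxr i j) (JF _ _ ((FP j).2 _)).
  have hi' := hi ltac:(move: ux ui; cyc).
  have hj' := hj ltac:(move: ux xj; cyc).
  by move: ux ui xj j2 j3 hi' hj'; cyc.
rewrite -E; apply: Lu.
- by move=> n; have [[]] := JP n.
- by move=> n x; rewrite !in_arc; exact: JS.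
- by rewrite E; exists u0, v0.
Qed.

(** The system is closed only under increasing unions. Along an ultrafilter of leaves tending to
    [{u, v}], the side of [{u, v}] on which each end lies is constant. Ends on the same closed side
    reduce to [union_leaf]; ends strictly on opposite sides are impossible. *)
Lemma is_leaf_closed : closed_leaves angle is_leaf.
Proof.
move=> u v uv H.
pose nbd (z : circle R * circle R * (circle R * circle R)) :=
  [/\ cc v z.1.1 u, cc u z.1.2 v, cc u z.2.1 v & cc v z.2.2 u].
pose B (z : circle R * circle R * (circle R * circle R)) :=
  [set w : circle R * circle R | [/\ is_leaf w.1 w.2, cc z.1.1 w.1 z.1.2 &
    cc z.2.1 w.2 z.2.2]].
have [a0 va0] := dense_circle (nesym uv); have [b0 ub0] := dense_circle uv.
have [|||U UU UB] := ultrafilter_of_base (D := nbd) (B := B).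
- by exists ((a0, b0), (b0, a0)).
- move=> [[a b] [c d]] [/= ? ? ? ?].
  have [||x [y [xy ax cy]]] := H a b c d; [by cyc_ctx..|].
  by exists (x, y).
- move=> [[a b] [c d]] [[a' b'] [c' d']] [/= va ub uc vd] [/= va' ub' uc' vd'].
  have [a2 [a2E aa aa']] := closest_left angI va va'.
  have [b2 [b2E bb bb']] := closest_right angI ub ub'.
  have [c2 [c2E cc1 cc1']] := closest_left angI uc uc'.
  have [d2 [d2E dd dd']] := closest_right angI vd vd'.
  exists ((a2, b2), (c2, d2)); first by split.
  move=> [x y] [/= xy ax cy]; split; split=> //=.
  - by move: va ub a2E aa b2E bb ax; cyc.
  - by move: uc vd c2E cc1 d2E dd cy; cyc.
  - by move: va' ub' a2E aa' b2E bb' ax; cyc.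
  - by move: uc' vd' c2E cc1' d2E dd' cy; cyc.
have Ul : U [set w | is_leaf w.1 w.2].
  by apply: filterS (UB ((a0, b0), (b0, a0)) _) => // w [].
have Ux : order_lim angle U fst u.
  move=> a b aub.
  have [||a' [a1 a2]] := shrink_left (th := angle) angI dense_circle (e := v) (u := u)
    (a := a).
  - exact: nesym.
  - by move: aub; cyc.
  have [||b' [b1 b2]] := shrink_right (th := angle) angI dense_circle (e := v) (u :=
    u) (b := b).
  - exact: nesym.
  - by move: aub; cyc.
  by apply: filterS (UB ((a', b'), (b0, a0)) _) => // w [/= _ ? _]; cyc_ctx.
have Uy : order_lim angle U snd v.
  move=> a b aub.
  have [||a' [a1 a2]] := shrink_left (th := angle) angI dense_circle (e := u) (u := v)
    (a := a).
  - exact: uv.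
  - by move: aub; cyc.
  have [||b' [b1 b2]] := shrink_right (th := angle) angI dense_circle (e := u) (u :=
    v) (b := b).
  - exact: uv.
  - by move: aub; cyc.
  by apply: filterS (UB ((a0, b0), (a', b')) _) => // w [/= _ _ ?]; cyc_ctx.
have half s t (x y : circle R * circle R -> circle R) : s <> t ->
  order_lim angle U x s -> order_lim angle U y t ->
    U [set w | is_leaf (x w) (y w)] ->
    U [set w | (x w = s \/ cc s (x w) t) /\ (y w = t \/ cc s (y w) t)] -> is_leaf s t.
  move=> st xs yt lxy inn; have [m sm] := dense_circle st.
  apply: (union_leaf st sm) => z sz.
  have [m1 [m1E m1m m1z]] := closest_right angI sm sz.
  have [m2 [m2E m2m m2z]] := closest_left angI sm sz.
  have n1 : cc t s m1 by move: m1E; cyc.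
  have n2 : cc m2 t s by move: m2E; cyc.
  have [w [[[hx hy] lw] [/= xw yw]]] := filter_ex (filterI (filterI inn lxy) (filterI
    (xs _ _ n1) (yt _ _ n2))).
  exists (x w), (y w); split=> //.
  - by move: hx hy m1E m1m m2E m2m xw yw sm; cyc.
  - by move: hx hy m1E m1m m2E m2m xw yw sm; cyc.
  - by move: hx hy m1E m1m m2E m2m xw yw sm; cyc.
  - by move: hx hy m1E m1z m2E m2z xw yw sz; cyc.
(* A second such leaf, with ends closer to [u] and [v], would cross the first. *)
have cross : U [set w | cc u w.1 v /\ cc v w.2 u] -> False.
  move=> out.
  have [w [[/= h1 h2] lw]] := filter_ex (filterI out Ul).
  have n1 : cc v u w.1 by move: h1; cyc.
  have n2 : cc u v w.2 by move: h2; cyc.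
  have [w' [[[/= h3 h4] lw'] [/= h5 h6]]] := filter_ex (filterI (filterI out Ul)
    (filterI (Ux _ _ n1) (Uy _ _ n2))).
  by apply: (is_leaf_unlinked lw (is_leaf_sym lw')); move: h1 h2 h3 h4 h5 h6; cyc.
have cross' : U [set w | cc v w.1 u /\ cc u w.2 v] -> False.
  move=> out.
  have [w [[/= h1 h2] lw]] := filter_ex (filterI out Ul).
  have n1 : cc w.1 u v by move: h1; cyc.
  have n2 : cc w.2 v u by move: h2; cyc.
  have [w' [[[/= h3 h4] lw'] [/= h5 h6]]] := filter_ex (filterI (filterI out Ul)
    (filterI (Ux _ _ n1) (Uy _ _ n2))).
  by apply: (is_leaf_unlinked lw lw'); move: h1 h2 h3 h4 h5 h6; cyc.
have Ul' : U [set w | is_leaf w.2 w.1] by apply: filterS Ul => w; exact: is_leaf_sym.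
have ultra3 (P Q Q' : set (circle R * circle R)) : (forall w, [\/ P w, Q w | Q' w]) ->
    [\/ U P, U Q | U Q'].
  move=> PQ; have [?|UP] := in_ultra_setVsetC P UU; first by constructor 1.
  have [?|UQ] := in_ultra_setVsetC Q UU; first by constructor 2.
  by constructor 3; apply: filterS2 UP UQ => w nP nQ; case: (PQ w).
have cut3 s t z : s <> t -> [\/ (z = s \/ z = t), cc s z t | cc t z s].
  move=> st; have [?|?] := boolP (cc s z t); first by constructor 2.
  by have [?|?] := boolP (cc t z s); [constructor 3|constructor 1; cyc_ctx].
have avoid s t (x : circle R * circle R -> circle R) : s <> t ->
  order_lim angle U x s -> U [set w | x w <> t].
  move=> st xs; have [a sa] := dense_circle st; have [b tb] := dense_circle (nesym st).
  have n : cc b s a by move: sa tb; cyc.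
  by apply: filterS (xs _ _ n) => w /=; move: sa tb; cyc.
have Nx := avoid _ _ _ uv Ux; have Ny := avoid _ _ _ (nesym uv) Uy.
have [X|X|X] := ultra3 _ _ _ (fun w => cut3 u v w.1 uv);
have [Y|Y|Y] := ultra3 _ _ _ (fun w => cut3 u v w.2 uv).
- apply: (half u v fst snd) => //.
  by apply: filterS2 (filterI X Y) (filterI Nx Ny) => w [/= ? ?] [/= ? ?]; cyc_ctx.
- apply: (half u v fst snd) => //.
  by apply: filterS2 (filterI X Y) (filterI Nx Ny) => w [/= ? ?] [/= ? ?]; cyc_ctx.
- apply: is_leaf_sym; apply: (half v u snd fst) => //; first exact: nesym.
  by apply: filterS2 (filterI X Y) (filterI Nx Ny) => w [/= ? ?] [/= ? ?]; cyc_ctx.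
- apply: (half u v fst snd) => //.
  by apply: filterS2 (filterI X Y) (filterI Nx Ny) => w [/= ? ?] [/= ? ?]; cyc_ctx.
- apply: (half u v fst snd) => //.
  by apply: filterS2 (filterI X Y) (filterI Nx Ny) => w [/= ? ?] [/= ? ?]; cyc_ctx.
- exfalso; apply: cross.
  by apply: filterS2 X Y => w /= ? ?.
- apply: is_leaf_sym; apply: (half v u snd fst) => //; first exact: nesym.
  by apply: filterS2 (filterI X Y) (filterI Nx Ny) => w [/= ? ?] [/= ? ?]; cyc_ctx.
- exfalso; apply: cross'.
  by apply: filterS2 X Y => w /= ? ?.
- apply: is_leaf_sym; apply: (half v u snd fst) => //; first exact: nesym.
  by apply: filterS2 (filterI X Y) (filterI Nx Ny) => w [/= ? ?] [/= ? ?]; cyc_ctx.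
Qed.

(* Such a pair is a side of the gap whose sides are the maximal arcs missing [p]. *)
Definition maximal_missing p u v := [/\ is_leaf u v, cc p u v &
  forall u' v', is_leaf u' v' -> cc p u' v' -> u' = u \/ cc p u' u ->
    v' = v \/ cc p v v' -> u' = u /\ v' = v].

(** * The gap formed by the maximal arcs missing a point *)

Section MissingArcs.
Variable p : circle R.
Hypotheses (pE : forall v, ~ is_leaf p v) (pR : ~ rainbow angle is_leaf p).

Lemma is_leaf_missing u v : is_leaf u v -> u <> p /\ v <> p.
Proof.
by move=> uv; split=> e; [apply: (pE (v := v))|apply: (pE (v := u));
  apply: is_leaf_sym]; rewrite -e.
Qed.

(** The larger arcs missing [p] form a chain, and the limits of their ends along an ultrafilter on
    this chain bound the maximal one. *)
Lemma maximal_missing_above u0 v0 : is_leaf u0 v0 -> cc p u0 v0 ->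
  exists u v, [/\ maximal_missing p u v, u = u0 \/ cc p u u0 & v = v0 \/ cc p v0 v].
Proof.
move=> l0 p0.
pose C (z : circle R * circle R) := [/\ is_leaf z.1 z.2, cc p z.1 z.2,
  z.1 = u0 \/ cc p z.1 u0 & z.2 = v0 \/ cc p v0 z.2].
pose above (z w : circle R * circle R) := (w.1 = z.1 \/ cc p w.1 z.1) /\
  (w.2 = z.2 \/ cc p z.2 w.2).
pose B z := [set w | C w /\ above z w].
have C0 : C (u0, v0) by split=> //; left.
have [|||U UU UB] := ultrafilter_of_base (D := C) (B := B).
- by exists (u0, v0).
- by move=> z Cz; exists z; split=> //; split; left.
- move=> z w Cz Cw; have [lz z1 z2 z3] := Cz; have [lw w1 w2 w3] := Cw.
  have [zw|zw] : above z w \/ above w z.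
    have := is_leaf_unlinked lz lw; have := is_leaf_unlinked lz (is_leaf_sym lw).
    rewrite /above.
    by move: z1 w1 z2 w2 z3 w3 p0; cyc.
  + exists w => // x [Cx [x1 x2]]; split; split=> //; split=> //.
    * by case: zw; move: x1 x2 {lz lw}; case: Cx => _; move: z1 w1; cyc.
    * by case: zw; move: x1 x2 {lz lw}; case: Cx => _; move: z1 w1; cyc.
  + exists z => // x [Cx [x1 x2]]; split; split=> //; split=> //.
    * by case: zw; move: x1 x2 {lz lw}; case: Cx => _; move: z1 w1; cyc.
    * by case: zw; move: x1 x2 {lz lw}; case: Cx => _; move: z1 w1; cyc.
have [u1 Uu] := order_lim_exists angI dense_circle complete_circle fst UU.
have [v1 Uv] := order_lim_exists angI dense_circle complete_circle snd UU.
have UC : U [set w | C w] by apply: filterS (UB _ C0) => w [].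
have u1E z : C z -> ~ cc z.1 u1 p.
  move=> Cz /Uu h; have [w [/= ? [Cw [? ?]]]] := filter_ex (filterI h (UB _ Cz)).
  by case: Cw => _; cyc_ctx.
have v1E z : C z -> ~ cc p v1 z.2.
  move=> Cz /Uv h; have [w [/= ? [Cw [? ?]]]] := filter_ex (filterI h (UB _ Cz)).
  by case: Cw => _; cyc_ctx.
(* Equal limits would be [p]; the arcs would exhaust the complement of [p] and their leaves form a
   rainbow there. *)
have uv1 : u1 <> v1.
  move=> uv; have up : u1 = p.
    by move: (u1E _ C0) (v1E _ C0); rewrite -uv /=; move: p0; cyc.
  apply: pR => a b apb.
  have [||a' [a1 a2]] := shrink_left angI dense_circle (e := v0) (u := p) (a := a);
    [by move: p0 apb; cyc..|].
  have [||b' [b1 b2]] := shrink_right angI dense_circle (e := u0) (u := p) (b := b);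
    [by move: p0 apb; cyc..|].
  have ab' : cc a' p b' by move: a1 b1 p0; cyc.
  have Ua : U [set w | cc a' w.1 b'] by apply: Uu; rewrite up.
  have Ub : U [set w | cc a' w.2 b'] by apply: Uv; rewrite -uv up.
  have [w [[/= w1 w2] [lw w3 w4 w5]]] := filter_ex (filterI (filterI Ua Ub) UC).
  exists w.2, w.1; split; first exact: is_leaf_sym.
    by move: a1 a2 b1 b2 w1 w2 w3 w4 w5 p0; cyc.
  by move: a1 a2 b1 b2 w1 w2 w3 w4 w5 p0; cyc.
have l1 : is_leaf u1 v1.
  apply: (leaf_lim is_leaf_closed _ _ Uu Uv) => //.
  by apply: filterS UC => w [].
have [u1p v1p] := is_leaf_missing l1.
have p1 : cc p u1 v1 by move: (u1E _ C0) (v1E _ C0) u1p v1p uv1 p0; rewrite /=; cyc.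
exists u1, v1; split.
- split=> // u' v' luv pu uu vv.
  have Cu : C (u', v').
    by split=> //=; move: (u1E _ C0) (v1E _ C0) uu vv p1 p0 u1p v1p; rewrite /=; cyc.
  by move: (u1E _ Cu) (v1E _ Cu) uu vv p1 pu; rewrite /=; cyc.
- by move: (u1E _ C0) u1p p0; rewrite /=; cyc.
- by move: (v1E _ C0) v1p p0; rewrite /=; cyc.
Qed.

Definition maximal_arcs : set (set (circle R)) :=
  [set I | exists u v, maximal_missing p u v /\ I = arc u v].

Lemma maximal_missing_inter u v u' v' x : maximal_missing p u v ->
  maximal_missing p u' v' -> cc u x v -> cc u' x v' -> u' = u /\ v' = v.
Proof.
move=> [l1 p1 m1] [l2 p2 m2] x1 x2.
have H1 := m1 _ _ l2 p2; have H2 := m2 _ _ l1 p1.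
have := is_leaf_unlinked l1 l2; have := is_leaf_unlinked l1 (is_leaf_sym l2).
by move: p1 p2 x1 x2 H1 H2; cyc.
Qed.

Lemma maximal_arcs_gap : gap L maximal_arcs.
Proof.
split.
- by move=> _ [u [v [[[_ ?] _ _] ->]]].
- move=> _ _ [u [v [muv ->]]] [u' [v' [muv' ->]]] [x []].
  rewrite /= !in_arc => x1 x2.
  by have [-> ->] := maximal_missing_inter muv muv' x1 x2.
move=> I /lamination_arc [u [v [luv ->]]].
have [up vp] := is_leaf_missing luv.
have H u' v' : is_leaf u' v' -> cc p u' v' -> exists2 J, maximal_arcs J &
  arc u' v' `<=` J.
  move=> luv' puv'; have [s [t [mst su tv]]] := maximal_missing_above luv' puv'.
  exists (arc s t); first by exists s, t.
  move=> x; rewrite !in_arc; case: mst => _ + _.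
  by move: su tv puv'; cyc.
have [puv|puv] := boolP (cc p u v).
  have [J mJ sub] := H _ _ luv puv; exists J => //.
  by exists (arc u v) => //; left.
have pvu : cc p v u by move: puv up vp (luv.1); cyc.
have [J mJ sub] := H _ _ (is_leaf_sym luv) pvu; exists J => //.
by exists (arc v u) => //; right; rewrite dual_arc //; exact: luv.1.
Qed.

(** With finitely many vertices, some [q] has none between [p] and itself. A point [r] there lies in
    a maximal arc, whose first end is a vertex between [p] and [r]. *)
Lemma maximal_arcs_infinite : ~ finite_set (vertices maximal_arcs).
Proof.
move=> /finite_seqP [s sE].
have vE x : vertices maximal_arcs x <-> x \in s by rewrite sE.
have [q qp qs] : exists2 q, q <> p & forall x, x \in s -> ~ cc p x q.
  have [[[I LI] _] _ _ _] := lamL.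
  have [u [v [luv _]]] := lamination_arc LI; have [up _] := is_leaf_missing luv.
  elim: s {sE vE} => [|y s [q qp IH]]; first by exists u.
  have [pyq|pyq] := boolP (cc p y q).
    exists y; first by move: pyq; cyc.
    move=> x; rewrite in_cons => /orP[/eqP ->|/IH]; first by move: pyq; cyc.
    by move: pyq; cyc.
  by exists q => // x; rewrite in_cons => /orP[/eqP ->|/IH //]; apply/negP.
have [r prq] := dense_circle (nesym qp).
have [c [d [mcd cr]]] : exists c d, maximal_missing p c d /\ cc c r d.
  have : ~ vertices maximal_arcs r by move=> /vE /qs.
  move=> /contrapT [_ [c [d [mcd ->]]]]; rewrite /= in_arc => cr.
  by exists c, d.
have [lcd pcd _] := mcd; have [cp _] := is_leaf_missing lcd.
have : vertices maximal_arcs c.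
  move=> [_ [c' [d' [mcd' ->]]]]; rewrite /= in_arc => cc'.
  have [e e1 e2] : exists2 e, cc c e d & cc c' e d'.
    have [pd _ _] := mcd'.
    have [dd|dd] := boolP (cc c d d').
      by have [e ce] := dense_circle lcd.1; exists e; move: ce dd cc'; cyc.
    have [e ce] : exists e, cc c e d' by apply: dense_circle; move: cc'; cyc.
    by exists e; move: ce dd cc' (lcd.1); cyc.
  have [e3 e4] := maximal_missing_inter mcd mcd' e1 e2.
  by move: cc'; rewrite e3; cyc.
by move=> /vE /qs; apply; move: prq cr pcd; cyc.
Qed.

End MissingArcs.

Lemma is_leaf_point p : very_full L -> (exists v, is_leaf p v) \/ rainbow angle is_leaf p.
Proof.
move=> vfL; apply: contrapT => /not_orP[pE pR].
have pE' v : ~ is_leaf p v by move=> h; apply: pE; exists v.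
exact: (maximal_arcs_infinite pE') (vfL _ (maximal_arcs_gap pE' pR)).
Qed.

Lemma is_leaf_relation : very_full L -> leaf_relation angle is_leaf.
Proof.
move=> vfL; split.
- exact: is_leaf_sym.
- by move=> u v [].
- exact: is_leaf_unlinked.
- exact: is_leaf_closed.
- have [[[I LI] _] _ _ _] := lamL.
  by have [u [v [luv _]]] := lamination_arc LI; exists u, v.
- by move=> p; exact: is_leaf_point.
Qed.

Lemma is_leaf_end_point p v : is_leaf p v -> end_points L p.
Proof.
move=> [pv Lpv]; exists (arc p v) => //; rewrite /vertices => -[I].
by case=> /= ->; rewrite ?dual_arc // in_arc; cyc.
Qed.

End Lamination.

(** * Uniform convergence *)

Section Topology.
Context {R : realType}.
Let angI := @angle_inj R.
Local Notation cc := (@cc R (circle R) angle).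
Implicit Types u v x y p : circle R.

Lemma norm_cis_sub t s (e : R) : 0 <= e -> 2 - 2 * cos s < e ^+ 2 ->
  `|cis t - cis (t + s)| < (e%:C)%C :> R[i].
Proof.
move=> e0 h; rewrite normc_def ltcR /= cosD sinD.
have -> : e = Num.sqrt (e ^+ 2) by rewrite sqrtr_sqr ger0_norm.
rewrite ltr_sqrt; last by have := cos_le1 s; lra.
apply: le_lt_trans h; rewrite le_eqVlt; apply/orP; left; apply/eqP.
have c1 := cos2Dsin2 t; have s1 := cos2Dsin2 s.
transitivity ((cos t ^+ 2 + sin t ^+ 2) * (1 - 2 * cos s + (cos s ^+ 2 + sin s ^+ 2))).
  by ring.
by rewrite c1 s1; ring.
Qed.

Lemma nbhs_angle p (A : set (circle R)) : nbhs p A ->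
  exists2 d : R, 0 < d & forall x s, val x = cis (angle p + s) :> R[i] -> `|s| < d -> A x.
Proof.
move=> [B [[/= W oW WB] Bp BA]].
have Wp : W (val p) by rewrite -WB in Bp.
have : nbhs (val p) W by apply: open_nbhs_nbhs.
move=> /nbhs_ballP [e /= e0 He].
(* The order of [R[i]] compares only numbers with equal imaginary parts, so a positive radius is
   real. *)
have [r r0 eE] : exists2 r : R, 0 < r & e = (r%:C)%C.
  by move: e0; clear; case: e => a b; rewrite ltcE /= => /andP[/eqP -> a0]; exists a.
(* The chord of angle [s] has squared length [2 - 2 * cos s], so it is shorter than [r] once
   [1 - cos s < r ^+ 2 / 2]. *)
have e20 : 0 < r ^+ 2 / 2 by rewrite divr_gt0 // exprn_gt0.
have /cvgrPdist_lt /(_ _ e20) := @continuous_cos R 0.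
move=> /nbhs_ballP [d /= d0 H]; exists d => // x s xs sd.
apply: BA; rewrite -WB /=; apply: He.
suff : `|cis (angle p) - cis (angle p + s)| < e by rewrite cis_angle -xs.
rewrite eE; apply: norm_cis_sub; first exact: ltW.
have := H s; rewrite /ball /= sub0r normrN cos0 => /(_ sd).
by rewrite ltr_norml => /andP[h1 h2]; lra.
Qed.

Definition rotated p (s : R) : circle R := point (angle p + s).

Lemma rotated_arc p (d : R) x : 0 < d < 1 -> cc (rotated p (- d)) x (rotated p d) ->
  exists2 s, `|s| < d & val x = cis (angle p + s) :> R[i].
Proof.
have p2 := @pi_ge2 R.
move=> /andP[d0 d1]; rewrite -ccwE => -[s [t [[s0 st t2] [xs dt]]]].
(* The bound [d < 1] keeps the arc below a full turn, so its angle is determined. *)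
have tE : t = 2 * d.
  apply: (@rotate_unique _ (rotated p (- d))); [by apply/andP; split; lra..|].
  by rewrite -dt /= cisD /= -[in RHS]cisD -cisD; congr cis; ring.
exists (s - d); first by rewrite ltr_norml; apply/andP; split; lra.
by rewrite xs /= -cisD; congr cis; ring.
Qed.

Lemma rotated_center p (d : R) : 0 < d < 1 -> cc (rotated p (- d)) p (rotated p d).
Proof.
have p2 := @pi_ge2 R.
move=> /andP[d0 d1]; rewrite -ccwE; exists d, (2 * d); split; first by split; lra.
split; first by rewrite -cis_angle /= -cisD; congr cis; ring.
by rewrite /= -cisD; congr cis; ring.
Qed.

Lemma compact_circle_closed (K : set (circle R)) : compact K -> closed K.
Proof.
move=> cK; apply: compact_closed cK.
move=> x y xy; apply: val_inj; apply: (@norm_hausdorff _ (R[i]^o)) => A B nA nB.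
have cv : continuous (val : circle R -> R[i]^o) by exact: initial_continuous.
have [z [Az Bz]] := xy _ _ (cv _ _ nA) (cv _ _ nB).
by exists (val z).
Qed.

(** Each [A j] meets every tail, since [U] contains the tails, so [k j] can be chosen beyond the
    previous index. *)
Lemma ultrafilter_subsequence (U : set_system nat) (A : nat -> set nat) :
  UltraFilter U -> \oo `<=` U -> (forall j, U (A j)) ->
  exists k : nat -> nat, {homo k : m n / (m < n)%N} /\ forall j, A j (k j).
Proof.
move=> UU ooU UA.
have [N NP] : {N : nat * nat -> nat & forall z, (z.2 < N z)%N /\ A z.1 (N z)}.
  apply: (@choice _ _ (fun (z : nat * nat) n => (z.2 < n)%N /\ A z.1 n)) => -[j m].
  have Um : U [set n | (m < n)%N] by apply: ooU; exists m.+1.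
  by have [n [? ?]] := filter_ex (filterI Um (UA j)); exists n.
pose k := fix k j := if j is j'.+1 then N (j, k j') else N (0%N, 0%N).
exists k; split; last by case=> [|j]; [exact: (NP (0, 0)%N).2|exact: (NP (j.+1, k j)).2].
by apply: homo_ltn; [exact: ltn_trans|move=> j; exact: (NP (j.+1, k j)).1].
Qed.

Lemma collapses_convergence (U : set_system nat) (g : nat -> circle R ->
  circle R) a b : UltraFilter U ->
  \oo `<=` U -> collapses angle U g a b -> convergence_property g.
Proof.
(* Starting from [1 / 2] keeps every radius below 1, as the lemmas on [rotated] require. *)
move=> UU ooU col; pose d j : R := j.+2%:R^-1.
have d01 j : 0 < d j < 1 by rewrite invr_gt0 ltr0n invf_lt1 ?ltr0n // ltr1n.
have dlt (e : R) : 0 < e -> \forall j \near \oo, d j < e.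
  move=> e0; have := near_infty_natSinv_lt (PosNum e0).
  by apply: filterS => j /=; apply: le_lt_trans; rewrite lef_pV2 ?posrE ?ltr0n // ler_nat.
(* The diagonal subsequence takes its term of rank [j] among the maps that are within [d j] of [a]
   outside the arc of radius [d j] around [b]. *)
pose A j := [set n | forall z, ~~ cc (rotated b (- d j)) z (rotated b (d j)) ->
   cc (rotated a (- d j)) (g n z) (rotated a (d j))].
have [|k [kh kA]] := ultrafilter_subsequence (A := A) UU ooU.
  by move=> j; apply: col; exact: rotated_center.
exists a, b, k; split=> // K cK Kb P /uniform_nbhs [E [entE EP]].
have nK : nbhs b (~` K).
  apply: open_nbhs_nbhs; split; last by move=> /Kb; exact.
  by apply: closed_openC; exact: compact_circle_closed.
have [e e0 eK] := nbhs_angle nK.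
have nE : nbhs a [set x | E (a, x)].
  by have := nbhs_entourage a entE; apply: filterS => x /xsectionP.
have [e' e'0 eE] := nbhs_angle nE.
apply: filterS2 (dlt _ e0) (dlt _ e'0) => j je je'; apply: EP => y Ky /=.
have [s sd es] : exists2 s, `|s| < d j & val (g (k j) y) = cis (angle a + s) :> R[i].
  apply: rotated_arc => //; apply: kA; apply/negP => /(rotated_arc (d01 j)) [s sd ys].
  exact: (eK _ _ ys (lt_trans sd je)).
exact: (eE _ _ es (lt_trans sd je')).
Qed.

End Topology.

(** * Homeomorphisms of the circle as maps of the cyclic order *)

Section GroupAction.
Context {R : realType}.
Let angI := @angle_inj R.

(** A triple out of order is degenerate or oppositely ordered; [g] preserves both properties, so it
    also reflects the order. *)
Lemma orientation_preserving_mono (g h : circle R -> circle R) :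
  orientation_preserving g -> cancel g h -> cyclic_mono angle g.
Proof.
move=> gop gK u p v; apply/idP/idP; last by rewrite -!ccwE; exact: gop.
have gI := can_inj gK.
have H : cc angle u v p -> cc angle (g u) (g v) (g p) by rewrite -!ccwE; exact: gop.
have H1 : u = p -> g u = g p by move=> ->.
have H2 : v = p -> g v = g p by move=> ->.
have H3 : u = v -> g u = g v by move=> ->.
by move: H H1 H2 H3; cyc.
Qed.

Lemma subgroup_homeo_group (G : set (circle R -> circle R)) :
  subgroup_homeo_plus G -> homeo_group angle G.
Proof.
move=> [Gh Gid Gc Gi]; split=> //.
- by move=> g /Gh [_ [h [_ gK _]] gop]; exact: orientation_preserving_mono gop gK.
- move=> g Gg; have [_ [h [_ gK hK]] _] := Gh _ Gg.
  by exists h; split=> //; exact: Gi Gg gK hK.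
Qed.

End GroupAction.

Theorem theorem1 (R : realType) (G : set (circle R -> circle R)) :
  pants_like_COL 3 G -> convergence_group G.
Proof.
move=> [Gsub [L [Llam Ltr Lend]]] g ginj Gg.
have GG := subgroup_homeo_group Gsub.
have LL i : leaf_relation angle (is_leaf (L i)).
  by have [? _ ?] := Llam i; exact: is_leaf_relation.
have LG i : invariant_leaves G (is_leaf (L i)).
  move=> k u v Gk [uv Luv]; have [_ inv _] := Llam i.
  have [h [_ kK hK]] := grp_inv GG Gk; have km := grp_mono GG Gk.
  by split; [move/(can_inj kK)|rewrite -(image_arc u v km hK); exact: inv].
have Ltrans i j u v : i <> j -> is_leaf (L i) u v -> ~ is_leaf (L j) u v.
  move=> /Ltr ij [_ Li] [_ Lj].
  by have : (L i `&` L j) (arc u v) by []; rewrite ij.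
have Lcusp i j p u v : i <> j -> is_leaf (L i) p u -> is_leaf (L j) p v -> cusp G p.
  move=> /Lend ij /is_leaf_end_point ip /is_leaf_end_point jp.
  have [k [Gk [_ _ [x [kx xU]]] kp]] := ij _ (conj ip jp).
  by exists k => // z; split=> [/xU <-|-> //]; exact: xU.
(* [U] contains the tails, so it is not principal and a sequence of distinct elements wanders along
   it. *)
have [U [UU ooU]] := ultraFilterLemma eventually_filter.
have gw : wandering G U g.
  split; first by apply: filterE.
  move=> k; have [[m gm]|nk] := pselect (exists m, g m = k); last first.
    by apply: filterE => n gn; apply: nk; exists n.
  apply: ooU; exists m.+1 => // n /= mn; rewrite -gm => /ginj nm.
  by rewrite nm ltnn in mn.
have [a [b col]] := wandering_collapses (@angle_inj R) dense_circle complete_circle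
  GG LL LG Ltrans Lcusp UU gw.
exact: collapses_convergence UU ooU col.
Qed.
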